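(* Let $(M,d)$ be a complete doubling metric space and let $\{\varphi_i : M\to M\}_{i\in I}$ be a properly semiconformal iterated function system on $M$ with invariant set $E$ and topological pressure $P$. Then the following conditions are equivalent: (1) the ball condition; (2) $\mathcal{H}^t(E)>0$, where $t\ge 0$ is given by $P(t)=0$; (3) the open set condition; (4) the strong open set condition.
   Context: Doubling: there is $\kappa\in\mathbb{N}$ such that every ball $B(x,2r)$ in $M$ can be covered by $\kappa$ balls of radius $r$. Balls $B(x,r)=\{y: d(x,y)<r\}$ are open. $\mathcal{H}^t$ is the $t$-dimensional Hausdorff measure. Words: $I$ is an index set with $2\le \#I<\infty$; $I^*=\bigcup_{n\ge1}I^n$, $I^\infty=I^{\mathbb{N}}$; $|\mathtt{i}|$ is the length of $\mathtt{i}\in I^*$; $\mathtt{i}\mathtt{j}$ is concatenation; $[\mathtt{i}]\subset I^\infty$ is the set of infinite words beginning with $\mathtt{i}$; $\mathtt{i}\perp\mathtt{j}$ means $[\mathtt{i}]\cap[\mathtt{j}]=\emptyset$; $\mathtt{i}^-$ is $\mathtt{i}$ with its last letter removed (for $|\mathtt{i}|\ge2$). Iterated function system (IFS): a family $\{\varphi_i\}_{i\in I}$ of injections $\varphi_i:M\to M$, each contractive, i.e. there is $0<s<1$ with $d(\varphi_i(x),\varphi_i(y))\le s\,d(x,y)$ for all $x,y\in M$. Its invariant set is the unique nonempty compact $E\subset M$ with $E=\bigcup_{i\in I}\varphi_i(E)$. For $\mathtt{i}=(i_1,\dots,i_n)$ put $\varphi_{\mathtt{i}}=\varphi_{i_1}\circ\cdots\circ\varphi_{i_n}$.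 Semiconformal: $\operatorname{diam}(E)>0$ and there are $D\ge1$ and $0<\underline{s}_{\mathtt{i}}\le\overline{s}_{\mathtt{i}}<1$ ($\mathtt{i}\in I^*$) with $\overline{s}_{\mathtt{i}}\le D\underline{s}_{\mathtt{i}}$ and $\underline{s}_{\mathtt{i}}d(x,y)\le d(\varphi_{\mathtt{i}}(x),\varphi_{\mathtt{i}}(y))\le\overline{s}_{\mathtt{i}}d(x,y)$ for all $x,y\in M$, $\mathtt{i}\in I^*$. Properly semiconformal: semiconformal, and there is a dense open set $W\subset M$ with $W\cap E\neq\emptyset$ and $W\ne M$ such that for each $x\in W$ there is $\lambda_x\ge1$ with $\operatorname{dist}(\varphi_{\mathtt{i}}(x),\varphi_{\mathtt{i}}(M\setminus W))\le\lambda_x\operatorname{dist}(\varphi_{\mathtt{i}}(x),M\setminus\varphi_{\mathtt{i}}(W))$ for every $\mathtt{i}\in I^*$. Pressure of a semiconformal IFS: $P(t)=\lim_{n\to\infty}\frac1n\log\sum_{\mathtt{i}\in I^n}\operatorname{diam}(\varphi_{\mathtt{i}}(E))^t$, $t\ge0$; it has a unique zero. Ball condition: with $X_{\mathtt{i}}=\varphi_{\mathtt{i}}(E)$, set $Z(r)=\{\mathtt{i}\in I^*:\operatorname{diam}(X_{\mathtt{i}})\le r<\operatorname{diam}(X_{\mathtt{i}^-})\}$ and $Z(x,r)=\{\mathtt{i}\in Z(r): X_{\mathtt{i}}\cap B(x,r)\ne\emptyset\}$. The ball condition holds if there is $0<\delta<1$ such that for every $x\in E$ there is $r_x>0$ so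 that for every $0<r<r_x$ there are points $x_{\mathtt{i}}\in M$, $\mathtt{i}\in Z(x,r)$, with $\operatorname{dist}(x_{\mathtt{i}},X_{\mathtt{i}})<r$ and with the balls $B(x_{\mathtt{i}},\delta r)$, $\mathtt{i}\in Z(x,r)$, pairwise disjoint. Open set condition (OSC): there is a nonempty open $U\subset M$ with $\varphi_{\mathtt{i}}(U)\cap\varphi_{\mathtt{j}}(U)=\emptyset$ whenever $\mathtt{i},\mathtt{j}\in I^*$, $\mathtt{i}\perp\mathtt{j}$. Strong open set condition (SOSC): such a $U$ exists with in addition $U\cap E\ne\emptyset$. *)

(* Defs.v *)
From HB Require Import structures.
From mathcomp Require Import all_boot all_order all_algebra.
From mathcomp Require Import all_classical all_reals all_analysis.

Set Implicit Arguments.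
Unset Strict Implicit.
Unset Printing Implicit Defensive.

Import Order.TTheory GRing.Theory Num.Theory.
Import numFieldNormedType.Exports.

Local Open Scope classical_set_scope.
Local Open Scope ring_scope.

(* Completeness is the library's convergence of Cauchy filters. The point that
   [Complete] carries is no restriction here: invariant sets are nonempty. *)
#[short(type="completeMetricType")]
HB.structure Definition CompleteMetric (R : numDomainType) :=
  {M of Metric R M & Complete M}.

(* [edist] is defined from balls. In a metric space it is the distance, so that
   [edist_inf A x] is dist(x, A), with the value +oo when A is empty. *)
Lemma edist_mdist (R : realType) (M : metricType R) (x y : M) :
  edist (x, y) = (mdist x y)%:E.
Proof.
rewrite /edist; apply/eqP; rewrite eq_le; apply/andP; split.
  apply/lee_addgt0Pr => e e0; apply: ereal_inf_lbound; exists (mdist x y + e) => //=.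
  by split; rewrite ?ballEmdist/= ?ltrDl// ltr_wpDl// mdist_ge0.
apply: le_ereal_inf_tmp => _ [r [_ +] <-]; rewrite ballEmdist/= lee_fin.
exact: ltW.
Qed.

Section metric.
Context {R : realType} {M : metricType R}.

Definition doubling : Prop :=
  exists kappa : nat, forall (x : M) (r : R), 0 < r ->
    exists c : 'I_kappa -> M, ball x (2 * r) `<=` \bigcup_i ball (c i) r.

(* The added 0 only matters for the empty set, whose diameter is 0. *)
Definition diam (A : set M) : \bar R :=
  ereal_sup (0%E |` [set (mdist x y)%:E | x in A & y in A]).

(* diam(U)^t, where the empty set counts for 0 even if t = 0. *)
Definition hausdorff_gauge (t : R) (U : set M) : \bar R :=
  (if U == set0 then 0 else diam U `^ t)%E.

Definition hausdorff_premeasure (t delta : R) (A : set M) : \bar R :=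
  ereal_inf [set (\sum_(0 <= k <oo) hausdorff_gauge t (U k))%E |
    U in [set U : nat -> set M | A `<=` \bigcup_k U k /\
                                 forall k, (diam (U k) <= delta%:E)%E]].

(* The supremum over delta > 0 is the limit as delta tends to 0, since the
   premeasure is nonincreasing in delta. *)
Definition hausdorff_measure (t : R) (A : set M) : \bar R :=
  ereal_sup [set hausdorff_premeasure t delta A | delta in [set d : R | 0 < d]].

End metric.

Arguments doubling {R} M.

(* A finite word is a [seq I]; the empty word, which is not in I^*, is excluded
   wherever words are quantified over. *)
Section words.
Context {I : finType}.
Implicit Types v w : seq I.

Definition cylinder w : set (nat -> I) := [set u | mkseq u (size w) = w].

Definition incomparable v w : Prop := cylinder v `&` cylinder w = set0.

Definition drop_last w : seq I := take (size w).-1 w.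

End words.

Section ifs.
Context {R : realType} {M : metricType R} {I : finType}.
Variable phi : I -> M -> M.
Implicit Types (E : set M) (v w : seq I).

Definition is_ifs : Prop := forall i, injective (phi i) /\
  exists s : R, 0 < s < 1 /\
    forall x y, mdist (phi i x) (phi i y) <= s * mdist x y.

Definition invariant_set E : Prop :=
  [/\ E !=set0, compact E & E = \bigcup_i (phi i @` E)].

(* [:: i1; ...; in] is sent to phi i1 \o ... \o phi in. *)
Definition word_map w : M -> M := foldr (fun i f => phi i \o f) id w.

Definition semiconformal E : Prop :=
  (0 < diam E)%E /\
  exists (D : R) (sl su : seq I -> R), 1 <= D /\
    forall w, w != [::] ->
      [/\ 0 < sl w, sl w <= su w, su w < 1, su w <= D * sl w &
        forall x y,
          sl w * mdist x y <= mdist (word_map w x) (word_map w y)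
                           <= su w * mdist x y].

Definition properly_semiconformal E : Prop :=
  semiconformal E /\
  exists W : set M,
    [/\ dense W, open W, W `&` E !=set0, W != setT &
      forall x, W x -> exists lambda : R, 1 <= lambda /\
        forall w, w != [::] ->
          (edist_inf (word_map w @` (~` W)) (word_map w x) <=
           lambda%:E * edist_inf (~` (word_map w @` W)) (word_map w x))%E].

Definition pressure E (t : R) : R :=
  lim ((n%:R^-1 *
    ln (\sum_(w : n.-tuple I) fine (diam (word_map w @` E)) `^ t)) @[n --> \oo]).

(* Words of length 1 are left out since drop_last leads outside I^*. They could
   only matter for r >= diam (phi i @` E), hence not for small r. *)
Definition stopping_words E (r : R) : set (seq I) :=
  [set w | [/\ (2 <= size w)%N, (diam (word_map w @` E) <= r%:E)%E &
               (r%:E < diam (word_map (drop_last w) @` E))%E]].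

Definition local_words E (x : M) (r : R) : set (seq I) :=
  [set w | stopping_words E r w /\ (word_map w @` E) `&` ball x r !=set0].

Definition ball_condition E : Prop :=
  exists delta : R, 0 < delta < 1 /\
  forall x, E x -> exists rx : R, 0 < rx /\
  forall r : R, 0 < r < rx -> exists p : seq I -> M,
    (forall w, local_words E x r w ->
       (edist_inf (word_map w @` E) (p w) < r%:E)%E) /\
    trivIset (local_words E x r) (fun w => ball (p w) (delta * r)).

Definition osc_set (U : set M) : Prop :=
  [/\ U !=set0, open U &
    forall v w, v != [::] -> w != [::] -> incomparable v w ->
      (word_map v @` U) `&` (word_map w @` U) = set0].

Definition open_set_condition : Prop := exists U, osc_set U.

Definition strong_open_set_condition E : Prop :=
  exists U, osc_set U /\ U `&` E !=set0.

(* t is the zero of the pressure on [0, +oo[. *)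
Definition pressure_zero E (t : R) : Prop :=
  unique (fun u => 0 <= u /\ pressure E u = 0) t.

End ifs.

(* Main.v *)
Require Import Defs.
From mathcomp Require Import all_boot all_order all_algebra.
From mathcomp Require Import all_classical all_reals all_analysis.
From mathcomp Require Import finmap ring lra.

Set Implicit Arguments.
Unset Strict Implicit.
Unset Printing Implicit Defensive.

Import Order.TTheory GRing.Theory Num.Theory.
Import numFieldNormedType.Exports.

Local Open Scope classical_set_scope.
Local Open Scope ring_scope.

(* Each of the four conditions is equivalent to a bound on clusters: for some
   eps > 0, the antichains of words whose pieces have diameter more than r and
   meet a common ball of radius eps r have bounded size.
   - If clusters are unbounded, the images of large clusters under the maps of the
     system give nested words, hence a point of E around which large clusters occur
     at arbitrarily small scales; doubling then contradicts the ball condition.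
   - Weigh a word by the t-th power of the diameter of its piece; at the zero t of
     the pressure the words of each length have total weight bounded above and
     below. Clusters are bounded if and only if every ball of radius r has weight
     O(r^t), which gives H^t(E) > 0 by mass distribution. Conversely, if the weight
     of some ball is much larger than r^t, replacing the pieces in it by one set,
     again and again in all images of the system, gives arbitrarily cheap covers.
   - If clusters are bounded, their maximal size does not change once eps is small.
     The map of a word p sends a maximal cluster for a much smaller eps to one that
     is still maximal, so that no piece of a word incomparable to p of at least the
     same size comes close to it. A small ball around a point of E in such a cluster
     thus satisfies the open set condition.
   - If U satisfies the open set condition, proper semiconformality at a point x of
     U and W gives disjoint balls around the images of x, of radii comparable to
     the diameters of the pieces; doubling then bounds the clusters. If x is close
     to E, these balls are those of the ball condition. *)

(** * Sums over the words of a given length *)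

Section word_sums.
Context {V : nmodType} {I : finType}.
Implicit Types (f : seq I -> V) (v w : seq I).

(** The summand is a function on [seq I] rather than on tuples, so that words of different lengths
    concatenate without casts. *)
Definition wsum n f : V := \sum_(w : n.-tuple I) f w.

Lemma wsum0 f : wsum 0 f = f [::].
Proof.
rewrite /wsum (big_pred1 [tuple])// => w.
by rewrite [w]tuple0; apply/esym/eqP.
Qed.

Lemma wsumS n f : wsum n.+1 f = \sum_i wsum n (fun w => f (i :: w)).
Proof.
rewrite /wsum (pair_big xpredT xpredT)/=.
rewrite (reindex (fun p : I * n.-tuple I => [tuple of p.1 :: p.2]))/=; first by [].
exists (fun w : n.+1.-tuple I => (thead w, [tuple of behead w])).
- by move=> [i w] _ /=; congr (_, _); apply: val_inj.
- by move=> w _; rewrite [RHS]tuple_eta; apply: val_inj.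
Qed.

Lemma wsumD m n f :
  wsum (m + n) f = wsum m (fun v => wsum n (fun w => f (v ++ w))).
Proof.
elim: m f => [|m IH] f; first by rewrite wsum0.
by rewrite addSn !wsumS; apply: eq_bigr => i _; rewrite IH.
Qed.

Lemma eq_wsum n f g : (forall w, size w = n -> f w = g w) ->
  wsum n f = wsum n g.
Proof. by move=> fg; apply: eq_bigr => w _; rewrite fg ?size_tuple. Qed.

Lemma wsum_prefix n v f : (size v <= n)%N ->
  wsum n (fun w => if prefix v w then f w else 0) =
  wsum (n - size v) (fun w => f (v ++ w)).
Proof.
elim: v n f => [|i v IH] [|n] f //=.
- by rewrite wsum0 prefix0s ?subn0 wsum0.
- by move=> _; rewrite subn0; apply: eq_wsum => w _; rewrite prefix0s.
- rewrite ltnS subSS => vn; rewrite wsumS -(IH _ (fun w => f (i :: w)))//.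
  rewrite (bigD1 i)//= [X in _ + X]big1 ?addr0.
    by apply: eq_wsum => w _; rewrite eqxx.
  move=> j ji; rewrite /wsum big1// => w _.
  by rewrite eq_sym (negbTE ji).
Qed.

End word_sums.

Section word_sums_order.
Context {R : realType} {I : finType}.
Implicit Types (f g : seq I -> R) (v w : seq I).

Lemma wsum_ge0 n f : (forall w, size w = n -> 0 <= f w) -> 0 <= wsum n f.
Proof. by move=> f0; apply: sumr_ge0 => w _; rewrite f0 ?size_tuple. Qed.

Lemma ler_wsum n f g : (forall w, size w = n -> f w <= g w) ->
  wsum n f <= wsum n g.
Proof. by move=> fg; apply: ler_sum => w _; rewrite fg ?size_tuple. Qed.

Lemma wsumMl n (a : R) f : wsum n (fun w => a * f w) = a * wsum n f.
Proof. by rewrite /wsum mulr_sumr. Qed.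

Lemma wsumMr n (a : R) f : wsum n (fun w => f w * a) = wsum n f * a.
Proof. by rewrite /wsum mulr_suml. Qed.

End word_sums_order.

(** * Quasi-additive sequences *)

Section quasi_additive.
Context {R : realType}.
Implicit Types (a : nat -> R) (c : R).

Lemma natmul_bounded_le0 (x b : R) : (forall n : nat, n%:R * x <= b) -> x <= 0.
Proof.
move=> H; rewrite leNgt; apply/negP => x0.
have := H (Num.truncn `|b / x|).+1; apply/negP; rewrite -ltNge -ltr_pdivrMr//.
by rewrite (le_lt_trans (ler_norm _))// Num.Theory.truncnS_gt.
Qed.

Lemma quasi_additive_mul a c : (forall m n, `|a (m + n)%N - a m - a n| <= c) ->
  forall m n, `|a (m.+1 * n)%N - m.+1%:R * a n| <= m%:R * c.
Proof.
move=> H; elim=> [|m IH] n; first by rewrite mul1n !mul1r subrr normr0 mul0r.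
rewrite mulSn (_ : _ - _ = (a (n + m.+1 * n)%N - a n - a (m.+1 * n)%N) +
  (a (m.+1 * n)%N - m.+1%:R * a n)); last first.
  rewrite (_ : m.+2%:R = 1 + m.+1%:R :> R) ?mulrDl ?mul1r; first by ring.
  by rewrite -natr1 addrC.
rewrite (le_trans (ler_normD _ _))//.
by rewrite -[in leRHS]nat1r mulrDl mul1r lerD.
Qed.

(** Comparing [a (m * n)] with both [m * a n] and [n * a m] shows that the intervals of radius
    [c / n] around [a n / n] meet pairwise. Their common point is the limit, and lying in all of
    them is a bound uniform in [n]. *)
Lemma quasi_additive_cvg a c :
  (forall m n, `|a (m + n)%N - a m - a n| <= c) ->
  exists p : R, (n%:R^-1 * a n @[n --> \oo] --> p) /\
    forall n, `|a n - n%:R * p| <= c.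
Proof.
move=> H; have c0 : 0 <= c by apply: le_trans (H 0%N 0%N).
pose u n := n.+1%:R^-1 * a n.+1.
have u_dist m n : `|u m - u n| <= c / m.+1%:R + c / n.+1%:R.
  have m0 : 0 < m.+1%:R :> R by [].
  have n0 : 0 < n.+1%:R :> R by [].
  have Hm := quasi_additive_mul H m n.+1.
  have Hn := quasi_additive_mul H n m.+1.
  rewrite mulnC in Hn.
  rewrite -(ler_pM2l (mulr_gt0 m0 n0)).
  rewrite -[X in X * `|_|](gtr0_norm (mulr_gt0 m0 n0)) -normrM.
  have -> : m.+1%:R * n.+1%:R * (c / m.+1%:R + c / n.+1%:R) = n.+1%:R * c + m.+1%:R * c.
    by field; rewrite !lt0r_neq0.
  have -> : m.+1%:R * n.+1%:R * (u m - u n) =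
     (a (m.+1 * n.+1)%N - m.+1%:R * a n.+1) - (a (m.+1 * n.+1)%N - n.+1%:R * a m.+1).
    by rewrite /u; field; rewrite !nat1r !pnatr_eq0.
  rewrite (le_trans (ler_normB _ _))// addrC lerD//.
  - by rewrite (le_trans Hn)// ler_wpM2r// ler_nat.
  - by rewrite (le_trans Hm)// ler_wpM2r// ler_nat.
(* The left ends of these intervals. Every right end bounds them all, so [sup A] lies in every
   interval. *)
pose A := [set x | exists m, x = u m - c / m.+1%:R].
have ubA n : ubound A (u n + c / n.+1%:R).
  move=> _ [m ->]; have := u_dist m n; rewrite ler_norml => /andP[_].
  by rewrite lerBlDr lerBlDl => /le_trans; apply; rewrite addrA addrAC.
have An n : A (u n - c / n.+1%:R) by exists n.
exists (sup A).
have bnd n : `|u n - sup A| <= c / n.+1%:R.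
  rewrite ler_distlC; apply/andP; split.
    by apply: ub_le_sup => //; exists (u 0%N + c / 1%:R); exact: ubA.
  by apply: ge_sup; [exists (u n - c / n.+1%:R)|exact: ubA].
split; last first.
  case=> [|n].
    by rewrite mul0r subr0 -normrN; have := H 0%N 0%N; rewrite subrr sub0r.
  have n0 : 0 < n.+1%:R :> R by [].
  have := bnd n; rewrite ler_pdivlMr// -[X in _ * X <= _]gtr0_norm// -normrM mulrBl.
  by rewrite /u mulrAC mulVf ?lt0r_neq0// mul1r [sup A * _]mulrC.
rewrite -cvg_shiftS; apply/cvgrPdist_le => e e0; near=> n.
rewrite distrC (le_trans (bnd n))// ler_pdivrMr// mulrC -ler_pdivrMr//.
by rewrite (@le_trans _ _ n%:R)// ?ler_nat//; near: n; exact: nbhs_infty_ger.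
Unshelve. all: by end_near. Qed.

End quasi_additive.

(** * The pressure function and its zero *)

Section pressure_function.
Context {R : realType} {I : finType}.
Variables (dm : seq I -> R) (C s eta : R).
Hypotheses (cardI : (2 <= #|I|)%N) (C1 : 1 <= C) (s01 : 0 < s < 1) (eta0 : 0 < eta).
Hypotheses (dm_gt0 : forall w, 0 < dm w)
  (dmM_le : forall v w, dm (v ++ w) <= C * dm v * dm w)
  (dmM_ge : forall v w, dm v * dm w <= C * dm (v ++ w))
  (dm_le : forall w, dm w <= dm [::] * s ^+ size w)
  (dm_ge : forall w, dm [::] * eta ^+ size w <= dm w).
Implicit Types t u : R.

Definition psum t n : R := wsum n (fun w => dm w `^ t).

Lemma psum_gt0 t n : 0 < psum t n.
Proof.
have [i _] : exists i : I, i \in I by apply/card_gt0P; exact: leq_trans cardI.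
rewrite /psum /wsum (bigD1 (nseq_tuple n i))//= ltr_wpDr ?powR_gt0//.
by apply: sumr_ge0 => w _; exact: powR_ge0.
Qed.

Lemma psumM_le t m n : 0 <= t -> psum t (m + n) <= C `^ t * psum t m * psum t n.
Proof.
move=> t0; rewrite /psum wsumD -mulrA -wsumMr -wsumMl; apply: ler_wsum => v _.
rewrite -!wsumMl; apply: ler_wsum => w _.
rewrite mulrA -!powRM ?mulr_ge0 ?(ltW (dm_gt0 _))// ?(le_trans _ C1)//.
by rewrite ge0_ler_powR ?nnegrE ?mulr_ge0 ?(ltW (dm_gt0 _))// (le_trans _ C1).
Qed.

Lemma psumM_ge t m n : 0 <= t -> psum t m * psum t n <= C `^ t * psum t (m + n).
Proof.
move=> t0; rewrite /psum wsumD -wsumMr -wsumMl; apply: ler_wsum => v _.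
rewrite -!wsumMl; apply: ler_wsum => w _.
rewrite -!powRM ?mulr_ge0 ?(ltW (dm_gt0 _))// ?(le_trans _ C1)//.
by rewrite ge0_ler_powR ?nnegrE ?mulr_ge0 ?(ltW (dm_gt0 _))// (le_trans _ C1).
Qed.

Lemma psum_quasi_additive t m n : 0 <= t ->
  `|ln (psum t (m + n)) - ln (psum t m) - ln (psum t n)| <= ln (C `^ t).
Proof.
move=> t0; have Ct : 0 < C `^ t by rewrite powR_gt0// (lt_le_trans _ C1).
have p0 k := psum_gt0 t k.
have := psumM_le m n t0.
rewrite -ler_ln ?posrE ?mulr_gt0// !lnM ?posrE ?mulr_gt0// => le1.
have := psumM_ge m n t0.
rewrite -ler_ln ?posrE ?mulr_gt0// !lnM ?posrE ?mulr_gt0// => le2.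
by rewrite ler_norml; apply/andP; split; lra.
Qed.

(** Convertible to [pressure phi E] when [dm] is [piece_diam phi E]. *)
Definition press t : R := lim (n%:R^-1 * ln (psum t n) @[n --> \oo]).

(** [ln (psum t n)] is quasi-additive in [n] because diameters are multiplicative up to [C]. The
    error does not grow with [n], so at a zero of the pressure all [psum t n] stay between two
    positive constants. *)
Lemma press_dist t n : 0 <= t -> `|ln (psum t n) - n%:R * press t| <= ln (C `^ t).
Proof.
move=> t0; have [p [cp pn]] :=
  quasi_additive_cvg (fun m n => psum_quasi_additive m n t0).
by rewrite /press (cvg_lim _ cp).
Qed.

Lemma press_le (t u : R) : 0 <= t <= u -> press u <= press t + (u - t) * ln s.
Proof.
move=> /andP[t0 tu]; have u0 := le_trans t0 tu; have [s0 _] := andP s01.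
rewrite -subr_le0; apply: (@natmul_bounded_le0 _ _
  (ln (C `^ u) + ln (C `^ t) + (u - t) * ln (dm [::]))) => n.
have : psum u n <= psum t n * (dm [::] * s ^+ n) `^ (u - t).
  rewrite /psum -wsumMr; apply: ler_wsum => w wn.
  have -> : dm w `^ u = dm w `^ t * dm w `^ (u - t).
    by rewrite -powRD ?lt0r_neq0 ?implybT// [t + _]addrC subrK.
  rewrite ler_wpM2l ?powR_ge0// ge0_ler_powR ?nnegrE ?subr_ge0 ?(ltW (dm_gt0 _))//.
    by rewrite mulr_ge0 ?(ltW (dm_gt0 _))// exprn_ge0// ltW.
  by rewrite -wn.
have sn : 0 < dm [::] * s ^+ n by rewrite mulr_gt0// exprn_gt0.
rewrite -ler_ln ?posrE ?mulr_gt0 ?psum_gt0 ?powR_gt0//.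
rewrite lnM ?posrE ?psum_gt0 ?powR_gt0// ln_powR lnM ?posrE ?exprn_gt0// lnXn//.
rewrite -[ln s *+ n]mulr_natl.
have /[1!ler_norml] /andP[_ b1] := press_dist n t0.
have /[1!ler_norml] /andP[a2 _] := press_dist n u0.
move: b1 a2; move: (ln _) (ln _) (ln (psum t n)) (ln (psum u n)) (ln s) (ln _).
move: (press t) (press u).
move=> A7 A8 A1 A2 A3 A4 A5 A6 b1 a2 c1.
nra.
Qed.

Lemma press_ge t u : 0 <= t <= u -> press t + (u - t) * ln eta <= press u.
Proof.
move=> /andP[t0 tu]; have u0 := le_trans t0 tu.
rewrite -subr_le0; apply: (@natmul_bounded_le0 _ _
  (ln (C `^ u) + ln (C `^ t) - (u - t) * ln (dm [::]))) => n.
have : psum t n * (dm [::] * eta ^+ n) `^ (u - t) <= psum u n.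
  rewrite /psum -wsumMr; apply: ler_wsum => w wn.
  have -> : dm w `^ u = dm w `^ t * dm w `^ (u - t).
    by rewrite -powRD ?lt0r_neq0 ?implybT// [t + _]addrC subrK.
  rewrite ler_wpM2l ?powR_ge0// ge0_ler_powR ?nnegrE ?subr_ge0 ?(ltW (dm_gt0 _))//.
    by rewrite mulr_ge0 ?(ltW (dm_gt0 _))// exprn_ge0// ltW.
  by rewrite -wn.
have sn : 0 < dm [::] * eta ^+ n by rewrite mulr_gt0// exprn_gt0.
rewrite -ler_ln ?posrE ?mulr_gt0 ?psum_gt0 ?powR_gt0//.
rewrite lnM ?posrE ?psum_gt0 ?powR_gt0// ln_powR lnM ?posrE ?exprn_gt0// lnXn//.
rewrite -[ln eta *+ n]mulr_natl.
have /[1!ler_norml] /andP[b1 _] := press_dist n t0.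
have /[1!ler_norml] /andP[_ a2] := press_dist n u0.
move: b1 a2; move: (ln _) (ln _) (ln (psum t n)) (ln (psum u n)) (ln eta) (ln _).
move: (press t) (press u).
move=> A7 A8 A1 A2 A3 A4 A5 A6 b1 a2 c1.
nra.
Qed.

Lemma press0_gt0 : 0 < press 0.
Proof.
have I0 : 1 < #|I|%:R :> R by rewrite ltr1n.
have psum0 n : psum 0 n = #|I|%:R ^+ n.
  rewrite /psum /wsum (eq_bigr (fun=> 1)) => [|w _]; last by rewrite powRr0.
  by rewrite sumr_const card_tuple -natrX.
rewrite (lt_le_trans (ln_gt0 I0))// -subr_le0.
apply: (@natmul_bounded_le0 _ _ (ln (C `^ 0))) => n.
have := press_dist n (lexx 0); rewrite psum0 lnXn ?(lt_trans _ I0)//.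
by rewrite -[_ *+ n]mulr_natl -mulrBr => /(le_trans (ler_norm _)).
Qed.

Lemma press_zero : exists t, [/\ 0 < t, press t = 0 &
  forall u, 0 <= u -> press u = 0 -> u = t].
Proof.
have [s0 s1] := andP s01.
have lns : ln s < 0 by rewrite ln_lt0.
(* [press_le] bounds the pressure at [b] by [press 0 + b * ln s], which vanishes for this choice. *)
pose b := press 0 / - ln s.
have b0 : 0 < b by rewrite divr_gt0 ?press0_gt0 ?oppr_gt0.
have pb : press b <= 0.
  have := @press_le 0 b; rewrite lexx ltW// => /(_ isT)/le_trans; apply.
  by rewrite subr0 /b invrN mulrN mulNr divfK ?subrr// lt_eqF.
pose k := Num.max (- ln s) (- ln eta).
have k0 : 0 < k by rewrite lt_max oppr_gt0 lns.
have lip (t u : R) : 0 <= t -> 0 <= u -> `|press t - press u| <= k * `|t - u|.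
  wlog tu : t u / t <= u.
    move=> H; have [tu|/ltW ut] := leP t u; first exact: H.
    by move=> t0 u0; rewrite distrC [ `|t - u|]distrC H.
  move=> t0 _; have [] := (@press_le t u, @press_ge t u).
  rewrite t0 tu => /(_ isT) h1 /(_ isT) h2.
  have ut : 0 <= u - t by rewrite subr_ge0.
  have m1 : (u - t) * (- ln eta) <= (u - t) * k by rewrite ler_wpM2l// le_max lexx orbT.
  have m2 : (u - t) * ln s <= 0 by rewrite mulr_ge0_le0// ltW.
  rewrite distrC [ `|t - u|]distrC [ `|u - t|]ger0_norm//.
  have m3 : 0 <= (u - t) * k by rewrite mulr_ge0// ltW.
  rewrite ler_norml [k * _]mulrC; apply/andP; split.
    by rewrite lerBrDl (le_trans _ h2)// lerD2l lerNl -mulrN.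
  by rewrite lerBlDl (le_trans h1)// lerD2l (le_trans m2).
(* The Lipschitz bound holds for nonnegative exponents; truncating the argument at 0 extends the
   function continuously to the line. *)
have [] := @IVT R (fun t => press (Num.max 0 t)) 0 b 0.
- exact: ltW.
- apply: continuous_subspaceT => x; apply/cvgrPdist_le => e e0; near=> y.
  rewrite (le_trans (lip _ _ _ _)) ?le_max ?lexx// -ler_pdivlMl//.
  have : `|Num.max 0 x - Num.max 0 y| <= `|x - y|.
    rewrite /Num.max; case: ltP => x0; case: ltP => y0.
    - by [].
    - by rewrite subr0 !ger0_norm ?subr_ge0 ?(le_trans y0)//; lra.
    - by rewrite sub0r normrN distrC !ger0_norm ?subr_ge0 ?(le_trans x0)//; lra.
    - by rewrite subrr normr0.
  move=> /le_trans; apply; near: y.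
  by apply: cvgr_dist_le; [exact: cvg_id|rewrite mulr_gt0 ?invr_gt0].
- rewrite maxxx [Num.max 0 b]max_r; last exact: ltW.
  apply/andP; split.
    by rewrite ge_min; apply/orP; right; exact: pb.
  by rewrite le_max; apply/orP; left; apply: ltW; exact: press0_gt0.
move=> t; rewrite in_itv/= => /andP[t0 tb]; rewrite max_r// => pt.
exists t; split=> //.
  rewrite lt_neqAle t0 andbT; apply: contraTN press0_gt0 => /eqP t00.
  by rewrite [X in press X]t00 pt ltxx.
have uniq_lt u v : 0 <= u -> u < v -> press u = 0 -> press v = 0 -> False.
  move=> u0 uv pu pv; have := @press_le u v; rewrite u0 ltW// => /(_ isT).
  by rewrite pu pv add0r; apply/negP; rewrite -ltNge pmulr_rlt0 ?subr_gt0.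
move=> u u0 pu; case: (ltgtP u t) => // h.
  by have := uniq_lt _ _ u0 h pu pt.
by have := uniq_lt _ _ t0 h pt pu.
Unshelve. all: by end_near. Qed.

Lemma psum_bounds t : 0 <= t -> press t = 0 ->
  exists2 B, 1 <= B & forall n, B^-1 <= psum t n <= B.
Proof.
move=> t0 pt; exists (C `^ t).
  have : 1 `^ t <= C `^ t by rewrite ge0_ler_powR ?nnegrE// (le_trans _ C1).
  by rewrite powR1.
move=> n; have Ct : 0 < C `^ t by rewrite powR_gt0// (lt_le_trans _ C1).
have := press_dist n t0; rewrite pt mulr0 subr0 ler_norml -lnV ?posrE//.
by rewrite !ler_ln ?posrE ?invr_gt0// psum_gt0.
Qed.

End pressure_function.

(** * Diameters and open balls *)

Section diameter.
Context {R : realType} {M : metricType R}.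
Implicit Types (A B : set M) (x y : M).

Lemma diam_ge0 A : (0 <= diam A)%E.
Proof. by apply: ereal_sup_ubound; left. Qed.

Lemma mdist_le_diam A x y : A x -> A y -> ((mdist x y)%:E <= diam A)%E.
Proof. by move=> Ax Ay; apply: ereal_sup_ubound; right; exists x => //; exists y. Qed.

Lemma diam_le A (b : R) : 0 <= b ->
  (forall x y, A x -> A y -> mdist x y <= b) -> (diam A <= b%:E)%E.
Proof.
move=> b0 H; apply: ge_ereal_sup => _ [->|[x Ax [y Ay <-]]]; rewrite lee_fin//.
exact: H.
Qed.

Lemma diam_set0 : diam (set0 : set M) = 0%E.
Proof. by apply/eqP; rewrite eq_le diam_ge0 andbT; apply: diam_le. Qed.

Lemma mball_open x (r : R) : open (ball x r).
Proof.
rewrite openE => y xy; apply/(nbhs_ballP y); exists (r - mdist x y) => /=.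
  by move: xy; rewrite ballEmdist/= subr_gt0.
move=> z; rewrite !ballEmdist/= => yz.
by rewrite (le_lt_trans (metric_triangle _ y _))// -ltrBrDl.
Qed.

End diameter.

Lemma compact_diam_lty {R : realType} {M : completeMetricType R} (A : set M) :
  compact A -> (diam A < +oo)%E.
Proof.
have [->|/set0P[a Aa]] := eqVneq A set0; first by rewrite diam_set0.
rewrite compact_cover => /(_ nat setT (fun n : nat => ball a n.+1%:R)).
case=> [n _|x Ax|D _ AD].
- exact: mball_open.
- exists (Num.truncn (mdist a x)) => //=.
  by rewrite ballEmdist/= truncnS_gt.
pose N := (\max_(n <- D) n)%N.
have aN x : A x -> mdist a x <= N.+1%:R.
  move=> /AD[n/= nD]; rewrite ballEmdist/= => /ltW/le_trans; apply.
  by rewrite ler_nat ltnS; rewrite /N; apply: leq_bigmax_seq.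
apply: (@le_lt_trans _ _ (N.+1%:R + N.+1%:R)%:E); last exact: ltry.
apply: diam_le => [//|x y Ax Ay]; rewrite (le_trans (metric_triangle _ a _))//.
by rewrite lerD ?aN// metric_sym aN.
Qed.


(** * Pieces, the images of the invariant set *)

Section word_maps.
Context {R : realType} {M : metricType R} {I : finType}.
Variables (phi : I -> M -> M) (E : set M).
Implicit Types (v w u : seq I).

Definition piece w : set M := word_map phi w @` E.

Definition piece_diam w : R := fine (diam (piece w)).

Lemma word_map_cat v w x : word_map phi (v ++ w) x = word_map phi v (word_map phi w x).
Proof. by elim: v => //= i v ->. Qed.

Lemma piece_cat v w : piece (v ++ w) = word_map phi v @` piece w.
Proof.
apply/seteqP; split => [_ [x Ex <-]|_ [_ [x Ex <-] <-]].
  by exists (word_map phi w x); [exists x|rewrite word_map_cat].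
by exists x => //; rewrite word_map_cat.
Qed.

Hypothesis HE : invariant_set phi E.

Lemma piece_nil : piece [::] = E.
Proof. by apply/seteqP; split => [_ [x Ex <-]//|x Ex]; exists x. Qed.

Lemma piece_sub w : piece w `<=` E.
Proof.
have [_ _ EE] := HE.
elim: w => [|i w IH]; first by rewrite piece_nil.
move=> _ [x Ex <-]; rewrite EE; exists i => //.
by exists (word_map phi w x) => //; apply: IH; exists x.
Qed.

Lemma piece_sub_cat v w : piece (v ++ w) `<=` piece v.
Proof. by rewrite piece_cat => _ [x /piece_sub Ex <-]; exists x. Qed.

Lemma piece_sub_prefix v w : prefix v w -> piece w `<=` piece v.
Proof. by move=> /prefixP[u ->]; exact: piece_sub_cat. Qed.

Lemma piece_neq0 w : exists x, piece w x.
Proof. by have [[x Ex] _ _] := HE; exists (word_map phi w x); exists x. Qed.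

Lemma piece_split w x : piece w x -> exists i, piece (rcons w i) x.
Proof.
have [_ _ EE] := HE.
move=> [y + <-]; rewrite {1}EE => -[i _ [z Ez <-]]; exists i; exists z => //.
by rewrite -cats1 word_map_cat.
Qed.

Lemma piece_extend v x n : piece v x ->
  exists2 u, size u = n & piece (v ++ u) x.
Proof.
move=> vx; elim: n => [|n [u <- ux]]; first by exists [::]; rewrite ?cats0.
have [i ix] := piece_split ux.
by exists (rcons u i); rewrite ?size_rcons// -rcons_cat.
Qed.

End word_maps.

(** * Distortion of the word maps *)

Section geometry.
Context {R : realType} {M : completeMetricType R} {I : finType}.
Variables (phi : I -> M -> M) (E : set M).
Implicit Types (v w u : seq I).

Local Notation dm := (piece_diam phi E).
Local Notation piece := (piece phi E).

(* Up to the constant [C], the map of a word multiplies distances by the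
   diameter of its piece; this makes the factors of [semiconformal] redundant. *)
Record ifs_geometry (C s eta : R) : Prop := IfsGeometry {
  geo_C1 : 1 <= C;
  geo_s : 0 < s < 1;
  geo_eta : 0 < eta < 1;
  geo_gt0 : forall w, 0 < dm w;
  geo_diam : forall w, diam (piece w) = (dm w)%:E;
  geo_lower : forall w x y,
    dm w * mdist x y <= C * mdist (word_map phi w x) (word_map phi w y);
  geo_upper : forall w x y,
    mdist (word_map phi w x) (word_map phi w y) <= C * dm w * mdist x y;
  geo_mul_le : forall v w, dm (v ++ w) <= C * dm v * dm w;
  geo_mul_ge : forall v w, dm v * dm w <= C * dm (v ++ w);
  geo_decay : forall w, dm w <= dm [::] * s ^+ size w;
  geo_step : forall w i, eta * dm w < dm (rcons w i) }.

(** The diameter of a piece lies between the two factors of its word times diam(E), and these differ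
    by at most the factor [D]. Hence the diameter can replace both, with a constant absorbing [D]
    and diam(E). *)
Lemma semiconformal_geometry : invariant_set phi E -> semiconformal phi E ->
  exists C s eta, ifs_geometry C s eta.
Proof.
move=> HE [diamE [D [sl [su [D1 Hw]]]]]; have [_ cE EE] := HE.
(* The empty word acts as the identity and gets the factors 1. *)
pose lo w := if w == [::] then 1 else sl w.
pose up w := if w == [::] then 1 else su w.
have lo0 w : 0 < lo w by rewrite /lo; case: eqP => // /eqP /Hw[].
have up_lo w : up w <= D * lo w.
  by rewrite /lo /up; case: eqP => [_|/eqP /Hw[]//]; rewrite mulr1.
have loP w x y : lo w * mdist x y <= mdist (word_map phi w x) (word_map phi w y).
  rewrite /lo; case: eqP => [->|/eqP /Hw[_ _ _ _ /(_ x y) /andP[]//]].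
  by rewrite mul1r.
have upP w x y : mdist (word_map phi w x) (word_map phi w y) <= up w * mdist x y.
  rewrite /up; case: eqP => [->|/eqP /Hw[_ _ _ _ /(_ x y) /andP[]//]].
  by rewrite mul1r.
have up0 w : 0 < up w.
  by rewrite /up; case: eqP => // /eqP /Hw[p0 p1 _ _ _]; exact: lt_le_trans p1.
have Efin : diam E \is a fin_num.
  by rewrite ge0_fin_numE ?diam_ge0// compact_diam_lty.
have Edist x y : E x -> E y -> mdist x y <= fine (diam E).
  by move=> Ex Ey; rewrite -lee_fin fineK// mdist_le_diam.
have d00 : 0 < fine (diam E) by rewrite fine_gt0// diamE ltey_eq Efin.
have fin w : diam (piece w) \is a fin_num.
  rewrite ge0_fin_numE ?diam_ge0// (@le_lt_trans _ _ (up w * fine (diam E))%:E) ?ltry//.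
  apply: diam_le => [|_ _ [x Ex <-] [y Ey <-]].
    by rewrite mulr_ge0 ?ltW// mulr_ge0.
  by rewrite (le_trans (upP _ _ _))// ler_wpM2l ?(ltW (up0 _))// Edist.
have dmE w : diam (piece w) = (dm w)%:E by rewrite fineK.
have dm_nil : dm [::] = fine (diam E) by rewrite /piece_diam piece_nil.
have dist_dm w x y : piece w x -> piece w y -> mdist x y <= dm w.
  by move=> wx wy; rewrite -lee_fin -dmE mdist_le_diam.
have dm_ub w (b : R) : 0 <= b ->
    (forall x y, piece w x -> piece w y -> mdist x y <= b) -> dm w <= b.
  by move=> b0 H; rewrite -lee_fin -dmE diam_le.
have dm0 w : 0 <= dm w by rewrite -lee_fin -dmE diam_ge0.
have lo_dm w : lo w * dm [::] <= dm w.
  rewrite mulrC -ler_pdivlMr//; apply: dm_ub; first by rewrite divr_ge0// ltW.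
  rewrite piece_nil => x y Ex Ey; rewrite ler_pdivlMr// mulrC.
  by rewrite (le_trans (loP _ _ _))// dist_dm//; [exists x|exists y].
have dm_up w : dm w <= up w * dm [::].
  apply: dm_ub; first by rewrite mulr_ge0// ltW.
  move=> _ _ [x Ex <-] [y Ey <-]; rewrite (le_trans (upP _ _ _))//.
  by rewrite ler_wpM2l ?(ltW (up0 _))// dm_nil Edist.
rewrite -dm_nil in d00.
have dm_gt0 w : 0 < dm w by rewrite (lt_le_trans _ (lo_dm w))// mulr_gt0.
(* At least [D], [D * dm [::]] and [D / dm [::]]; only these bounds are kept below. *)
pose C := D * (1 + dm [::] + (dm [::])^-1).
have d0V : 0 < (dm [::])^-1 by rewrite invr_gt0.
have D0 : 0 < D by rewrite (lt_le_trans _ D1).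
have C1 : 1 <= C.
  by rewrite (le_trans D1)// ler_peMr ?(ltW D0)// -addrA lerDl addr_ge0 ?ltW.
have C0 : 0 < C by rewrite (lt_le_trans _ C1).
have CD : D * dm [::] <= C by rewrite ler_wpM2l ?(ltW D0)// addrAC lerDr addr_ge0 ?ltW.
have CDV : D * (dm [::])^-1 <= C by rewrite ler_wpM2l ?(ltW D0)// lerDr addr_ge0 ?ltW.
move: C C1 C0 CD CDV => C C1 C0 CD CDV.
have lower w x y : dm w * mdist x y <= C * mdist (word_map phi w x) (word_map phi w y).
  apply: (@le_trans _ _ (D * dm [::] * (lo w * mdist x y))).
    rewrite mulrA ler_wpM2r ?mdist_ge0// (le_trans (dm_up w))//.
    by rewrite mulrAC ler_wpM2r ?dm0.
  by apply: ler_pM; rewrite ?mulr_ge0 ?mdist_ge0 ?(ltW (lo0 _)) ?(ltW D0).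
have upper w x y : mdist (word_map phi w x) (word_map phi w y) <= C * dm w * mdist x y.
  rewrite (le_trans (upP _ _ _))// ler_wpM2r ?mdist_ge0// (le_trans (up_lo w))//.
  apply: (@le_trans _ _ (D * (dm [::])^-1 * dm w)); last by rewrite ler_wpM2r.
  by rewrite -mulrA ler_wpM2l ?(ltW D0)// mulrC ler_pdivlMr.
have mul_le v w : dm (v ++ w) <= C * dm v * dm w.
  apply: dm_ub; first by rewrite !mulr_ge0// ltW.
  rewrite piece_cat => _ _ [x wx <-] [y wy <-]; rewrite (le_trans (upper _ _ _))//.
  by rewrite ler_wpM2l ?dist_dm// mulr_ge0// ltW.
have mul_ge v w : dm v * dm w <= C * dm (v ++ w).
  rewrite mulrC -ler_pdivlMr//; apply: dm_ub.
    by rewrite ltW// divr_gt0 ?mulr_gt0.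
  move=> x y wx wy; rewrite ler_pdivlMr// mulrC (le_trans (lower _ _ _))//.
  by rewrite ler_wpM2l ?(ltW C0)// dist_dm// piece_cat; [exists x|exists y].
pose s := \big[Order.max/2^-1]_(i : I) su [:: i].
have s0 : 0 < s by rewrite (@lt_le_trans _ _ 2^-1) ?bigmax_ge_id// invr_gt0.
have s1 : s < 1.
  apply/bigmax_ltP; split; first by rewrite invf_lt1 ?ltr1n.
  by move=> i _; have [] := Hw [:: i] isT.
have decay w : dm w <= dm [::] * s ^+ size w.
  elim: w => [|i w IH]; first by rewrite mulr1.
  rewrite exprS mulrCA (@le_trans _ _ (s * dm w)) ?ler_wpM2l ?(ltW s0)//.
  apply: dm_ub; first by rewrite ltW ?mulr_gt0.
  rewrite -cat1s piece_cat => _ _ [x wx <-] [y wy <-].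
  rewrite (le_trans (upP _ _ _))// ler_pM ?mdist_ge0 ?(ltW (up0 _)) ?dist_dm//.
  by rewrite /up/=; exact: le_bigmax.
(* By [mul_ge] the letter [i] shrinks a piece at most by the factor [dm [:: i] / C]; the 2 makes
   [geo_step] strict. *)
pose eta := \big[Order.min/2^-1]_(i : I) (dm [:: i] / (2 * C)).
have eta0 : 0 < eta.
  apply/bigmin_gtP; split; first by rewrite invr_gt0.
  by move=> i _; rewrite divr_gt0 ?mulr_gt0.
have eta1 : eta < 1.
  by rewrite (@le_lt_trans _ _ 2^-1) ?bigmin_le_id// invf_lt1 ?ltr1n.
exists C, s, eta; split=> //; rewrite ?s0 ?eta0//.
move=> w i; have : eta <= dm [:: i] / (2 * C) by exact: bigmin_le_cond.
rewrite ler_pdivlMr ?mulr_gt0// => h.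
have := mul_ge w [:: i]; rewrite cats1 => h2.
rewrite -(ltr_pM2l C0) (lt_le_trans _ h2)//.
have h3 : 0 < eta * C by rewrite mulr_gt0.
rewrite (_ : C * _ = dm w * (eta * C)); last by ring.
rewrite ltr_pM2l// (lt_le_trans _ h)//.
by rewrite mulrCA mulr_natl mulr2n ltrDl.
Qed.

End geometry.

(** * Prefixes and antichains *)

Section prefixes.
Context {I : finType}.
Implicit Types (v w u : seq I).

Definition antichain (Q : seq (seq I)) : Prop :=
  uniq Q /\ {in Q &, forall v w, prefix v w -> v = w}.

Lemma prefix_total v w u : prefix v u -> prefix w u -> prefix v w || prefix w v.
Proof.
rewrite !prefixE => /eqP vu /eqP wu; case: (leqP (size v) (size w)) => vw.
  by rewrite -{1}wu take_takel// vu eqxx.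
by rewrite -{3}vu take_takel ?(ltnW vw)// wu eqxx orbT.
Qed.

(** Two prefixes of one infinite word are comparable. Conversely, the longer of two comparable
    words, continued by a fixed letter, lies in both cylinders; this takes a letter. *)
Lemma incomparableP v w : #|I| != 0%N ->
  incomparable v w <-> ~~ prefix v w /\ ~~ prefix w v.
Proof.
move=> I0; have [i0 _] : exists i : I, i \in I by apply/card_gt0P; rewrite lt0n.
have cyl_nth u z : prefix u z -> cylinder u (nth i0 z).
  move=> /prefixP[y ->]; apply: (@eq_from_nth _ i0); rewrite size_mkseq// => k ku.
  by rewrite nth_mkseq// nth_cat ku.
have cyl_prefix z u : cylinder u z -> forall n, (size u <= n)%N -> prefix u (mkseq z n).
  move=> zu n un; rewrite prefixE -[X in _ == X]zu; apply/eqP.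
  by rewrite /mkseq -map_take take_iota (minn_idPl un).
split=> [vw|[nvw nwv]].
  have no_mem z : cylinder v z -> cylinder w z -> False.
    by move=> zv zw; have : (cylinder v `&` cylinder w) z by []; rewrite vw.
  split; apply/negP => p; [apply: (no_mem (nth i0 w))|apply: (no_mem (nth i0 v))];
    by apply: cyl_nth => //; exact: prefix_refl.
apply/seteqP; split => // z [zv zw].
have := prefix_total (cyl_prefix _ _ zv _ (leq_maxl _ (size w)))
  (cyl_prefix _ _ zw _ (leq_maxr (size v) _)).
by rewrite (negbTE nvw) (negbTE nwv).
Qed.

Lemma drop_last_rcons v i : drop_last (rcons v i) = v.
Proof. by rewrite /drop_last size_rcons/= -cats1 take_size_cat. Qed.

End prefixes.

(** * Stopping words and clusters *)

Section stopping.
Context {R : realType} {M : completeMetricType R} {I : finType}.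
Variables (phi : I -> M -> M) (E : set M) (C s eta : R).
Implicit Types (v w u : seq I) (Q : seq (seq I)).

Local Notation dm := (piece_diam phi E).
Local Notation piece := (piece phi E).
Local Notation word_map := (word_map phi).

Hypotheses (HE : invariant_set phi E) (G : ifs_geometry phi E C s eta).

Let C1 := geo_C1 G.
Let C0 : 0 < C. Proof. exact: lt_le_trans C1. Qed.
Let dm_gt0 := geo_gt0 G.
Let s0 : 0 < s. Proof. by have /andP[] := geo_s G. Qed.
Let s1 : s < 1. Proof. by have /andP[] := geo_s G. Qed.
Let eta0 : 0 < eta. Proof. by have /andP[] := geo_eta G. Qed.

Lemma mdist_dm w x y : piece w x -> piece w y -> mdist x y <= dm w.
Proof. by move=> wx wy; rewrite -lee_fin -(geo_diam G) mdist_le_diam. Qed.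

Lemma dm_prefix v w : prefix v w -> dm w <= dm v.
Proof.
move=> /(piece_sub_prefix HE) vw; rewrite -lee_fin -!(geo_diam G).
rewrite [leRHS](geo_diam G); apply: diam_le; first exact: ltW.
by move=> x y /vw vx /vw vy; exact: mdist_dm.
Qed.

Lemma dm_small (rho : R) : 0 < rho ->
  exists n, forall w, (n <= size w)%N -> dm w < rho.
Proof.
move=> rho0; have /cvgrPdist_lt/(_ _ rho0) : dm [::] * s ^+ n @[n --> \oo] --> (0 : R).
  rewrite -(mulr0 (dm [::])); apply: cvgM; first exact: cvg_cst.
  by apply: cvg_expr; rewrite gtr0_norm.
move=> [n _ Hn]; exists n => w nw; rewrite (le_lt_trans (geo_decay G w))//.
have := Hn (size w) nw; rewrite /= sub0r normrN gtr0_norm// mulr_gt0 ?exprn_gt0//.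
Qed.

Lemma dm_ge_expr w : dm [::] * eta ^+ size w <= dm w.
Proof.
elim/last_ind: w => [|w i IH]; first by rewrite mulr1.
rewrite size_rcons exprS mulrCA (le_trans _ (ltW (geo_step G w i)))//.
by rewrite ler_pM2l.
Qed.

(** Unlike in [stopping_words], a word of length 1 may stop. The empty word never does, since it is
    its own [drop_last]. *)
Definition stops (rho : R) w : Prop := dm w <= rho < dm (drop_last w).

Lemma stops_ge rho w : stops rho w -> eta * rho < dm w.
Proof.
rewrite /stops; case/lastP: w => [|w i].
  by rewrite /drop_last/= => /andP[/le_lt_trans/[apply]]; rewrite ltxx.
rewrite drop_last_rcons => /andP[_ h]; rewrite (lt_trans _ (geo_step G w i))//.
by rewrite ltr_pM2l.
Qed.

(** The parent of a proper extension of [v] still extends [v], so its piece already has diameter at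
    most [rho]. *)
Lemma stops_prefix_eq rho v w : stops rho v -> stops rho w -> prefix v w -> v = w.
Proof.
move=> /andP[v1 _] /andP[_ w2] /prefixP[u wE]; move: w2; rewrite {}wE.
case/lastP: u => [|u i]; first by rewrite cats0.
rewrite -rcons_cat drop_last_rcons => h.
by have := lt_le_trans h (le_trans (dm_prefix (prefix_prefix _ _)) v1); rewrite ltxx.
Qed.

Lemma stops_rcons rho w : stops rho w ->
  exists v i, [/\ w = rcons v i, dm w <= rho & rho < dm v].
Proof.
rewrite /stops; case/lastP: w => [|w i].
  by rewrite /drop_last/= => /andP[/le_lt_trans/[apply]]; rewrite ltxx.
by rewrite drop_last_rcons => /andP[h1 h2]; exists w, i.
Qed.

Lemma stops_neq0 rho w : stops rho w -> w != [::].
Proof.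
by case: w => // /andP[/le_lt_trans/[apply]]; rewrite /drop_last/= ltxx.
Qed.

Lemma stopping_prefix rho v w : rho < dm v -> prefix v w -> dm w <= rho ->
  exists u, [/\ prefix v u, v != u, prefix u w & stops rho u].
Proof.
move=> vrho /prefixP[z ->].
elim/last_ind: z => [|z i IH]; first by rewrite cats0 leNgt vrho.
rewrite -rcons_cat => h; have [vz|vz] := leP (dm (v ++ z)) rho.
  have [u [h1 h2 h3 h4]] := IH vz; exists u; split=> //.
  exact: prefix_trans h3 (prefix_rcons _ _).
have su : stops rho (rcons (v ++ z) i) by rewrite /stops drop_last_rcons h.
exists (rcons (v ++ z) i); split; rewrite ?prefix_refl//.
  by rewrite rcons_cat prefix_prefix.
apply/eqP => /(congr1 size); rewrite size_rcons size_cat => /eqP.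
by rewrite -addnS -{1}[size v]addn0 eqn_add2l.
Qed.

Lemma stopping_extend rho v e : 0 < rho < dm v -> piece v e ->
  exists u, [/\ prefix v u, v != u, piece u e & stops rho u].
Proof.
move=> /andP[rho0 vrho] ve; have [n Hn] := dm_small rho0.
have [u nu ue] := piece_extend HE n ve.
have [|y [h1 h2 h3 h4]] := stopping_prefix vrho (prefix_prefix v u).
  by rewrite ltW// Hn// size_cat nu leq_addl.
by exists y; split=> //; exact: (piece_sub_prefix HE h3).
Qed.

(** Words are nonempty so that the strictly longer ones in [cluster_refine] have length at least 2,
    as [stopping_words] demands. *)
Definition word_cluster (eps : R) Q x (r : R) : Prop :=
  [/\ 0 < r, antichain Q, [::] \notin Q &
    {in Q, forall w, r < dm w /\ exists2 e, piece w e & mdist x e < eps * r}].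

Definition bounded_clusters : Prop := exists2 eps : R, 0 < eps &
  exists K : nat, forall Q x r, word_cluster eps Q x r -> (size Q <= K)%N.

Lemma cluster_le eps eps' Q x r : eps <= eps' ->
  word_cluster eps Q x r -> word_cluster eps' Q x r.
Proof.
move=> ee [r0 aQ nQ HQ]; split=> // w /HQ[h [e we xe]]; split=> //.
by exists e => //; rewrite (lt_le_trans xe)// ler_wpM2r// ltW.
Qed.

(** The map of [p] turns the distance [eps * r] into at most [C * dm p * eps * r], while diameters
    above [r] become diameters above [dm p * r / C]. The quotient of the two scales grows by
    [C ^+ 2]. *)
Lemma cluster_image eps Q x r p : word_cluster eps Q x r ->
  word_cluster (C ^+ 2 * eps) (map (cat p) Q) (word_map p x) (dm p * r / C).
Proof.
move=> [r0 [uQ aQ] nQ HQ]; split.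
- by rewrite divr_gt0// mulr_gt0.
- split; first by rewrite map_inj_uniq// => v w /eqP; rewrite eqseq_cat// eqxx => /eqP.
  move=> _ _ /mapP[v vQ ->] /mapP[w wQ ->]; rewrite prefix_catr// eqxx/=.
  by move=> /(aQ _ _ vQ wQ) ->.
- apply/mapP => -[w wQ /esym/eqP]; rewrite -size_eq0 size_cat addn_eq0 => /andP[_].
  by rewrite size_eq0 => /eqP w0; move: nQ; rewrite -w0 wQ.
- move=> _ /mapP[w wQ ->]; have [h [e we xe]] := HQ _ wQ; split.
    by rewrite ltr_pdivrMr// [_ * C]mulrC (lt_le_trans _ (geo_mul_ge G _ _))// ltr_pM2l.
  exists (word_map p e); first by rewrite piece_cat; exists e.
  rewrite (le_lt_trans (geo_upper G _ _ _))//.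
  rewrite (_ : _ * (_ / _) = C * dm p * (eps * r)); last by field; exact: lt0r_neq0.
  by rewrite ltr_pM2l// mulr_gt0.
Qed.

Lemma cluster_refine eps Q x r : word_cluster eps Q x r -> exists Q',
  [/\ size Q' = size Q, antichain Q', [::] \notin Q' & {in Q', forall w,
    [/\ stops r w, (2 <= size w)%N & exists2 e, piece w e & mdist x e < eps * r]}].
Proof.
move=> [r0 [uQ aQ] nQ HQ].
have /choice[f Hf] : forall w, exists u, w \in Q -> [/\ prefix w u, stops r u,
    (2 <= size u)%N & exists2 e, piece u e & mdist x e < eps * r].
  move=> w; have [wQ|_] := boolP (w \in Q); last by exists [::].
  have [rw [e we xe]] := HQ _ wQ.
  have [|u [h1 h2 h3 h4]] := @stopping_extend r w e _ we; first by rewrite r0.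
  exists u => _; split=> //; last by exists e.
  have /prefixP[z uE] := h1; rewrite uE size_cat.
  have : (0 < size w)%N by rewrite lt0n size_eq0; apply: contraNneq nQ => <-.
  have : (0 < size z)%N.
    by rewrite lt0n size_eq0; apply: contraNneq h2 => z0; rewrite uE z0 cats0.
  by case: (size w) => // a; case: (size z) => // b; rewrite addSn addnS.
have f_inj : {in Q &, injective f}.
  move=> v w vQ wQ fvw; have [pv _ _ _] := Hf _ vQ; have [pw _ _ _] := Hf _ wQ.
  rewrite fvw in pv; case/orP: (prefix_total pv pw); first exact: aQ.
  by move=> /(aQ _ _ wQ vQ).
exists (map f Q); split; first by rewrite size_map.
- split; first by rewrite map_inj_in_uniq.
  move=> _ _ /mapP[v vQ ->] /mapP[w wQ ->].
  by have [_ sv _ _] := Hf _ vQ; have [_ sw _ _] := Hf _ wQ; exact: (stops_prefix_eq sv sw).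
- by apply/mapP => -[w /Hf[_ /stops_neq0/eqP + _ _]] => /[swap] <-.
- by move=> _ /mapP[w /Hf[_ ? ? ?] ->].
Qed.

End stopping.

(** * Distances to sets and packing in doubling spaces *)

Section distances.
Context {R : realType} {M : metricType R}.
Implicit Types (A : set M) (x y : M).

Lemma edist_inf_le A x y : A y -> (edist_inf A x <= (mdist x y)%:E)%E.
Proof. by move=> Ay; apply: ereal_inf_lbound; exists y => //; rewrite edist_mdist. Qed.

Lemma edist_inf_ltP A x (r : R) : (edist_inf A x < r%:E)%E ->
  exists2 y, A y & mdist x y < r.
Proof. by move=> /ereal_inf_lt[_ [y Ay <-]]; rewrite edist_mdist lte_fin; exists y. Qed.

Lemma edist_inf_ge A x (r : R) : (forall y, A y -> r <= mdist x y) ->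
  (r%:E <= edist_inf A x)%E.
Proof.
by move=> H; apply: le_ereal_inf_tmp => _ [y Ay <-]; rewrite edist_mdist lee_fin H.
Qed.

Hypothesis dM : doubling M.

Lemma doubling_iter m : exists k : nat, forall x (r : R), 0 < r ->
  exists c : 'I_k -> M, ball x (2 ^+ m * r) `<=` \bigcup_i ball (c i) r.
Proof.
have [kappa Hk] := dM.
elim: m => [|m [k IH]].
  by exists 1%N => x r r0; exists (fun=> x); rewrite mul1r => y; exists ord0.
exists #|{: 'I_k * 'I_kappa}|%N => x r r0.
have [|c Hc] := IH x (2 * r); first by rewrite mulr_gt0.
have /choice[d Hd] : forall i, exists d : 'I_kappa -> M,
    ball (c i) (2 * r) `<=` \bigcup_j ball (d j) r by move=> i; exact: Hk.
exists (fun n => let ij := enum_val n in d ij.1 ij.2) => y.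
rewrite exprSr -mulrA => /Hc[i _ /Hd[j _ dy]].
by exists (enum_rank (i, j)) => //; rewrite enum_rankK.
Qed.

(** Cover the large ball by [k] balls of radius [r]. If two points [f v] and [f w] lie in the same
    one, its centre belongs to the [r]-balls around both, so [v = w]. *)
Lemma packing (a : R) : exists K : nat, forall (T : eqType) (Q : seq T)
    (f : T -> M) x (r : R), 0 < r -> uniq Q ->
  {in Q, forall w, mdist x (f w) < a * r} ->
  {in Q &, forall v w, ball (f v) r `&` ball (f w) r !=set0 -> v = w} ->
  (size Q <= K)%N.
Proof.
have [k Hk] := doubling_iter (Num.truncn a).+1.
exists k => T Q f x r r0 uQ Qx Qd; have [c Hc] := Hk x r r0.
have cQ w : w \in Q -> exists i, ball (c i) r (f w).
  move=> /Qx xw; have [|i _ ?] := Hc (f w); last by exists i.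
  rewrite ballEmdist/= (lt_le_trans xw)// ler_wpM2r ?(ltW r0)//.
  by rewrite (le_trans (ltW (truncnS_gt a)))// -natrX ler_nat ltnW// ltn_expl.
case: Q uQ Qx Qd cQ => [//|w0 Q] uQ Qx Qd cQ; have [i0 _] := cQ w0 (mem_head _ _).
have /choice[g Hg] : forall w, exists i, w \in w0 :: Q -> ball (c i) r (f w).
  move=> w; have [/cQ[i ?]|_] := boolP (w \in w0 :: Q); first by exists i.
  by exists i0.
have g_inj : {in w0 :: Q &, injective g}.
  move=> v w vQ wQ gvw; apply: Qd => //; exists (c (g v)); split.
    by apply: ball_sym; exact: Hg.
  by rewrite gvw; apply: ball_sym; exact: Hg.
rewrite -(size_map g) -[leqRHS](size_enum_ord k) uniq_leq_size ?map_inj_in_uniq//.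
by move=> i _; rewrite mem_enum.
Qed.

End distances.

(** * Bounded clusters from the ball condition, and separation from bounded clusters *)

Section separation.
Context {R : realType} {M : completeMetricType R} {I : finType}.
Variables (phi : I -> M -> M) (E : set M) (C s eta : R).
Implicit Types (v w u p q : seq I) (Q : seq (seq I)).

Local Notation dm := (piece_diam phi E).
Local Notation piece := (piece phi E).
Local Notation word_map := (word_map phi).
Local Notation stops := (stops phi E).
Local Notation word_cluster := (word_cluster phi E).
Local Notation bounded_clusters := (bounded_clusters phi E).

Hypotheses (HE : invariant_set phi E) (G : ifs_geometry phi E C s eta).
Hypothesis cardI : #|I| != 0%N.

Let C1 := geo_C1 G.
Let C0 : 0 < C. Proof. exact: lt_le_trans C1. Qed.
Let dm_gt0 := geo_gt0 G.
Let eta0 : 0 < eta. Proof. by have /andP[] := geo_eta G. Qed.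

Lemma local_wordsP x (r : R) w : local_words phi E x r w <->
  [/\ stops r w, (2 <= size w)%N & exists2 e, piece w e & mdist x e < r].
Proof.
rewrite /local_words /stopping_words/=.
rewrite -/(piece _) -/(piece (drop_last w)) !(geo_diam G) lee_fin lte_fin ballEmdist.
split=> [[[sw w1 w2] [e [we xe]]]|[/andP[w1 w2] sw [e we xe]]].
  by split=> //; [apply/andP|exists e].
by split=> //; exists e.
Qed.

Lemma unbounded_clusters : ~ bounded_clusters -> forall eps, 0 < eps ->
  forall K, exists Q x r, word_cluster eps Q x r /\ (K < size Q)%N.
Proof.
move=> nb eps eps0 K; apply: contrapT => H; apply: nb; exists eps => //.
exists K => Q x r cQ; rewrite leqNgt; apply/negP => KQ.
by apply: H; exists Q, x, r.
Qed.

(** Points chosen in the pieces have a cluster point in the compact set [E]; as the pieces decrease,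
    it lies in the closure of each. *)
Lemma nested_pieces_point (p : nat -> seq I) :
  (forall n, prefix (p n) (p n.+1)) ->
  exists2 z, E z & forall n, closure (piece (p n)) z.
Proof.
move=> pS; have p_mono n k : prefix (p n) (p (n + k)%N).
  elim: k => [|k IH]; first by rewrite addn0 prefix_refl.
  by rewrite addnS (prefix_trans IH).
have /choice[e He] : forall n, exists e, piece (p n) e by move=> n; exact: piece_neq0.
have [_ cE _] := HE.
have [|z [Ez Hz]] := cE (e @ \oo) _.
  by exists 0%N => // n _; exact: (piece_sub HE (He n)).
exists z => // n B Bz; apply: Hz => //.
exists n => // m /= nm; apply: (piece_sub_prefix HE _ (He m)).
by rewrite -(subnKC nm).
Qed.

Lemma ball_condition_bounded_clusters :
  doubling M -> ball_condition phi E -> bounded_clusters.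
Proof.
move=> dM [delta [/andP[d0 d1] bc]]; apply: contrapT => nb.
(* At scale [rho] the points of the ball condition lie within [3 * rho] of the centre, and their
   disjoint balls have radius [delta * rho]. *)
have [K HK] := packing dM (4 / delta).
have C20 : 0 < C ^+ 2 by rewrite exprn_gt0.
(* With this [eps], [cluster_image] gives clusters for 1/4. *)
have e0 : 0 < (4 * C ^+ 2)^-1 by rewrite invr_gt0 mulr_gt0.
have [Q [x [r [cQ KQ]]]] := unbounded_clusters nb e0 K.
have r0 : 0 < r by case: cQ.
pose rho p := dm p * r / C.
have rho0 p : 0 < rho p by rewrite divr_gt0// mulr_gt0.
(* The word [p'] prolongs an image [p ++ w0] of a cluster word until its piece has diameter at most
   [rho p / 4]. A point [z] of the closure is then within [3 * (rho p / 4)] of [word_map p x]: a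
   quarter each for the cluster distance, the diameter and the closure. The last quarter brings the
   whole image cluster within [rho p] of [z]. *)
have /choice[f Hf] : forall p, exists p', [/\ prefix p p', (size p < size p')%N &
  forall z, closure (piece p') z -> exists Q', [/\ (K < size Q')%N, uniq Q' &
    {in Q', forall w, local_words phi E z (rho p) w}]].
  move=> p; have := cluster_image G p cQ; rewrite -/(rho p).
  have -> : C ^+ 2 * (4 * C ^+ 2)^-1 = 4^-1 by field; exact: lt0r_neq0.
  move=> [_ aQ nQ HQ].
  have : exists w0, w0 \in Q by case: (Q) KQ => // w0 ? _; exists w0; exact: mem_head.
  move=> [w0 w0Q]; have [h [e we xe]] := HQ _ (map_f (cat p) w0Q).
  have [|u [pu wu ue su]] := stopping_extend HE G (_ : 0 < rho p / 4 < _) we.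
    by rewrite divr_gt0//= (lt_trans _ h)// ltr_pdivrMr// ltr_pMr// ltr1n.
  exists u; split.
  - exact: (prefix_trans (prefix_prefix p w0) pu).
  - rewrite (@leq_ltn_trans (size (p ++ w0)))//; first by rewrite size_cat leq_addr.
    have /prefixP[[|i y] uE] := pu; first by rewrite uE cats0 eqxx in wu.
    by rewrite uE !size_cat/= -addnA ltn_add2l addnS ltnS leq_addr.
  move=> z uz; have [|e' [ue' ze']] := uz (ball z (rho p / 4)).
    by apply: nbhsx_ballx; rewrite divr_gt0.
  rewrite ballEmdist/= in ze'.
  have xz : mdist (word_map p x) z < 3 * (rho p / 4).
    rewrite (le_lt_trans (metric_triangle _ e _))// (_ : 3 * (rho p / 4) =
      4^-1 * rho p + (rho p / 4 + rho p / 4)); last by field.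
    rewrite ltrD// (le_lt_trans (metric_triangle _ e' _))// ler_ltD//.
      by rewrite (le_trans (mdist_dm G ue ue'))//; case/andP: su.
    by rewrite metric_sym.
  have [|Q' [sQ [uQ' _] _ HQ']] :=
      @cluster_refine _ _ _ _ _ _ _ _ HE G 1 (map (cat p) Q) z (rho p).
    split=> //; move=> w /HQ[hw [ew wew xew]]; split=> //; exists ew => //.
    rewrite (le_lt_trans (metric_triangle _ (word_map p x) _))// metric_sym.
    by rewrite (_ : 1 * rho p = 3 * (rho p / 4) + 4^-1 * rho p) ?ltrD//; field.
  exists Q'; split=> //; first by rewrite sQ size_map.
  move=> w /HQ'[h1 h2 [e2 h3 h4]]; apply/local_wordsP; split=> //.
  by exists e2 => //; rewrite -[ltRHS]mul1r.
pose p n := iter n f [::].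
have pS n : prefix (p n) (p n.+1) by have [] := Hf (p n).
have p_size n : (n <= size (p n))%N.
  by elim: n => // n IH; rewrite (leq_ltn_trans IH)//; have [] := Hf (p n).
have [z Ez Hz] := nested_pieces_point pS.
have [rx [rx0 Hrx]] := bc z Ez.
have [|n Hn] := @dm_small _ _ _ _ _ _ _ _ G (rx * C / r).
  by rewrite divr_gt0// mulr_gt0.
have rho_rx : 0 < rho (p n) < rx.
  by rewrite rho0/= ltr_pdivrMr// -ltr_pdivlMr// Hn.
have [q [q1 q2]] := Hrx _ rho_rx.
have [_ _ /(_ z (Hz n.+1))[Q' [KQ' uQ' HQ']]] := Hf (p n).
have := HK _ Q' q z (delta * rho (p n)) (mulr_gt0 d0 (rho0 _)) uQ'.
rewrite leqNgt KQ' => H; apply: (notF (H _ _)) => [w wQ|v w vQ wQ].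
- have [e1 we1 qe1] := edist_inf_ltP (q1 _ (HQ' _ wQ)).
  have /local_wordsP[/andP[sw _] _ [e2 we2 ze2]] := HQ' _ wQ.
  rewrite mulrA divfK ?lt0r_neq0//.
  have e12 := mdist_dm G we2 we1.
  have t1 := metric_triangle z e2 (q w); have t2 := metric_triangle e2 e1 (q w).
  rewrite metric_sym in qe1.
  by move: (rho0 (p n)); lra.
- by apply: q2; exact: HQ'.
Qed.

Lemma singleton_cluster eps : 0 < eps -> exists w x r, word_cluster eps [:: w] x r.
Proof.
move=> eps0; have [i _] : exists i : I, i \in I by apply/card_gt0P; rewrite lt0n.
have [e ie] := piece_neq0 HE [:: i].
exists [:: i], e, (dm [:: i] / 2); split=> //.
- by rewrite divr_gt0.
- by split=> // v w; rewrite !inE => /eqP -> /eqP ->.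
- move=> w; rewrite inE => /eqP ->; split.
    by rewrite ltr_pdivrMr// ltr_pMr// ltr1n.
  by exists e => //; rewrite mdistxx mulr_gt0// divr_gt0.
Qed.

(** [T] is the least bound valid for some [eps]. Being least, it is reached for every [eps]. *)
Lemma maximal_cluster : bounded_clusters -> exists eps0 T, [/\ 0 < eps0,
  forall Q x r, word_cluster eps0 Q x r -> (size Q <= T)%N &
  forall eps, 0 < eps -> exists Q x r,
    [/\ word_cluster eps Q x r, (0 < size Q)%N & (T <= size Q)%N]].
Proof.
move=> [eps1 eps1_0 [K HK]].
pose P n := `[< exists2 eps : R, 0 < eps &
  forall Q x r, word_cluster eps Q x r -> (size Q <= n)%N >].
have exP : exists n, P n by exists K; apply/asboolP; exists eps1.
case: (ex_minnP exP) => T /asboolP[eps0 eps00 HT] Tmin.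
exists eps0, T; split=> // eps e0.
(* For [T = 0] a singleton serves, since the cluster must be nonempty. *)
case: T HT Tmin => [|T] HT Tmin.
  have [w [x [r cw]]] := singleton_cluster e0.
  by exists [:: w], x, r.
apply: contrapT => H; suff /Tmin : P T by rewrite ltnn.
apply/asboolP; exists eps => // Q x r cQ; rewrite leqNgt; apply/negP => TQ.
by apply: H; exists Q, x, r; split=> //; exact: leq_trans TQ.
Qed.

(** If the images of the chosen ball under incomparable words [p] and [q] met, a prefix of [q] could
    be added to the image of the maximal cluster under [p], giving more than [T] words. *)
Lemma bounded_clusters_sosc : bounded_clusters -> strong_open_set_condition phi E.
Proof.
move=> /maximal_cluster[eps0 [T [eps00 HT Tex]]].
have C20 : 0 < C ^+ 2 by rewrite exprn_gt0.
(* Two images cost [C ^+ 2] each, and moving the centre to a point of [E] costs 2. *)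
pose eps1 := eps0 / (2 * C ^+ 4).
have eps10 : 0 < eps1 by rewrite divr_gt0 ?mulr_gt0 ?exprn_gt0.
have [Q0 [x0 [r0 [cQ0 Q00 TQ0]]]] := Tex _ eps10.
have r00 : 0 < r0 by case: cQ0.
(* The image under a long word has scale [r1 < eta], so that [r'] below is less than
   [eta * dm p]. *)
have [n Hn] : exists n, forall w, (n <= size w)%N -> dm w < eta * C / r0.
  by apply: (dm_small G); rewrite divr_gt0 ?mulr_gt0.
have [i0 _] : exists i : I, i \in I by apply/card_gt0P; rewrite lt0n.
have := cluster_image G (nseq n i0) cQ0.
move: (Hn (nseq n i0)); rewrite size_nseq => /(_ (leqnn n)).
rewrite ltr_pdivlMr// -ltr_pdivrMr//.
move: (word_map _ _) (_ / C) => x1 r1 r1eta cQ1; set Q1 := map _ _ in cQ1.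
have sQ1 : size Q1 = size Q0 by rewrite size_map.
have [r10 aQ1 nQ1 HQ1] := cQ1.
have [w0 w0Q] : exists w0, w0 \in Q1.
  by rewrite -sQ1 in Q00; case: (Q1) Q00 => // w ? _; exists w; exact: mem_head.
have [_ [y w0y x1y]] := HQ1 _ w0Q.
have Ey := piece_sub HE w0y.
have cy : word_cluster (2 * (C ^+ 2 * eps1)) Q1 y r1.
  split=> // w /HQ1[h [e we xe]]; split=> //; exists e => //.
  rewrite (le_lt_trans (metric_triangle _ x1 _))// metric_sym.
  by rewrite -mulrA mulr_natl mulr2n ltrD.
(* Chosen so that [2 * (C * dm p * rho) = eps0 * r']. *)
pose rho := eps0 * r1 / (2 * C ^+ 2).
have rho0 : 0 < rho by rewrite divr_gt0 ?mulr_gt0.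
exists (ball y rho); split; last by exists y; split=> //; exact: ballxx.
split; [by exists y; exact: ballxx|exact: mball_open|].
have main p q a b : p != [::] -> q != [::] -> ~~ prefix p q -> ~~ prefix q p ->
    dm q <= dm p -> mdist y a < rho -> mdist y b < rho ->
    word_map p a = word_map q b -> False.
  move=> p0 q0 npq nqp qp ya yb ab.
  pose r' := dm p * r1 / C.
  have r'eta : r' < eta * dm p.
    rewrite /r' ltr_pdivrMr// [dm p * r1]mulrC [ltRHS]mulrAC ltr_pM2r//.
    rewrite (lt_le_trans r1eta)//.
    by rewrite ler_peMr// ltW.
  have cp := cluster_image G p cy; rewrite -/r' in cp.
  (* If the piece of [q] is too small for the cluster, [q'] is the parent of the first prefix of [q]
     with diameter at most [r']. Then [dm q' < r' / eta < dm p], so [q'] is not a prefix of [p]. *)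
  have [q' [q'0 q'q nq'p npq' q'r]] : exists q', [/\ q' != [::], prefix q' q,
      ~~ prefix q' p, ~~ prefix p q' & r' < dm q'].
    have [qr|qr] := ltP r' (dm q); first by exists q; split=> //; exact: prefix_refl.
    case: (q) q0 npq nqp qr => [//|i q2] _ npq nqp qr.
    have [||u [u1 u2 u3 u4]] := @stopping_prefix _ _ _ phi E r' [:: i] (i :: q2) _ _ qr.
    - rewrite (lt_le_trans r'eta)// (le_trans _ (ltW (geo_step G [::] i)))//.
      by rewrite ler_pM2l// (dm_prefix HE G)// prefix0s.
    - by rewrite /= eqxx prefix0s.
    have [q' [j [uE ur q'r]]] := stops_rcons u4.
    have q'q : prefix q' (i :: q2) by apply: prefix_trans u3; rewrite uE prefix_rcons.
    exists q'; split=> //.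
    - by apply: contraNneq u2 => q'0; move: u1; rewrite uE q'0 prefixs1/= eq_sym.
    - apply/negP => /(dm_prefix HE G) pq'; have := geo_step G q' j; rewrite -uE.
      move=> /lt_le_trans/(_ ur)/lt_trans/(_ r'eta); rewrite ltr_pM2l//.
      by rewrite ltNge pq'.
    - by apply: contra npq => /prefix_trans; apply.
  have np u : ~~ prefix q' (p ++ u) /\ ~~ prefix (p ++ u) q'.
    split; apply/negP => h.
      by have := prefix_total h (prefix_prefix p u); rewrite (negbTE nq'p) (negbTE npq').
    by move: npq'; rewrite (prefix_trans (prefix_prefix p u) h).
  have : word_cluster eps0 (q' :: map (cat p) Q1) (word_map p y) r'.
    have [h1 [uQ aQ] nQ HQ] := cp.
    have epsE : C ^+ 2 * (2 * (C ^+ 2 * eps1)) = eps0.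
      by rewrite /eps1; field; exact: lt0r_neq0.
    rewrite epsE in HQ.
    split=> //.
    - split.
        rewrite /= uQ andbT; apply/mapP => -[u _ q'u].
        by have [] := np u; rewrite -q'u prefix_refl.
      move=> v w; rewrite !inE => /orP[/eqP ->|vQ] /orP[/eqP ->|wQ] //.
      + by case/mapP: wQ => u _ ->; have [/negbTE ->] := np u.
      + by case/mapP: vQ => u _ ->; have [_ /negbTE ->] := np u.
      + exact: aQ.
    - by rewrite inE negb_or nQ eq_sym q'0.
    - move=> w; rewrite inE => /orP[/eqP ->|/HQ//]; split=> //.
      (* The images of [y] under [p] and [q] are both within [C * dm p * rho] of the common image
         point; for [q] this uses [dm q <= dm p]. *)
      exists (word_map q y); first by apply: (piece_sub_prefix HE q'q); exists y.
      rewrite (le_lt_trans (metric_triangle _ (word_map p a) _))//.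
      have ap : mdist (word_map p y) (word_map p a) < C * dm p * rho.
        by rewrite (le_lt_trans (geo_upper G _ _ _))// ltr_pM2l// mulr_gt0.
      have bq : mdist (word_map p a) (word_map q y) < C * dm p * rho.
        rewrite ab metric_sym (le_lt_trans (geo_upper G _ _ _))//.
        rewrite (@le_lt_trans _ _ (C * dm p * mdist y b))// ?ltr_pM2l ?mulr_gt0//.
        by rewrite ler_wpM2r ?mdist_ge0// ler_pM2l.
      rewrite (_ : eps0 * r' = C * dm p * rho + C * dm p * rho) ?ltrD//.
      by rewrite /r' /rho; field; exact: lt0r_neq0.
  by move=> /HT; rewrite /= size_map sQ1 ltnNge TQ0.
move=> p q p0 q0 /incomparableP-/(_ cardI)[npq nqp].
apply/seteqP; split=> // z [[a ya za] [b yb zb]].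
rewrite ballEmdist/= in ya yb.
have [qp|/ltW pq] := leP (dm q) (dm p).
  by apply: (main p q a b) => //; rewrite za zb.
by apply: (main q p b a) => //; rewrite za zb.
Qed.

End separation.

(** * From open sets to disjoint balls *)

Section open_sets.
Context {R : realType} {M : completeMetricType R} {I : finType}.
Variables (phi : I -> M -> M) (E : set M) (C s eta : R).
Implicit Types (v w u p q : seq I) (Q : seq (seq I)).

Local Notation dm := (piece_diam phi E).
Local Notation piece := (piece phi E).
Local Notation word_map := (word_map phi).
Local Notation stops := (stops phi E).
Local Notation word_cluster := (word_cluster phi E).
Local Notation bounded_clusters := (bounded_clusters phi E).

Hypotheses (HE : invariant_set phi E) (G : ifs_geometry phi E C s eta).
Hypothesis cardI : #|I| != 0%N.

Let C1 := geo_C1 G.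
Let C0 : 0 < C. Proof. exact: lt_le_trans C1. Qed.
Let dm_gt0 := geo_gt0 G.
Let eta0 : 0 < eta. Proof. by have /andP[] := geo_eta G. Qed.


(* Where [proper_factor] holds, the maps of all words are open with uniform
   constants, although they need not be open elsewhere. *)
Definition proper_factor W x (lambda : R) := 1 <= lambda /\ forall w, w != [::] ->
  (edist_inf (word_map w @` (~` W)) (word_map w x) <=
   lambda%:E * edist_inf (~` (word_map w @` W)) (word_map w x))%E.

(** The image of [x] is at distance at least [dm w * rho / C] from the image of the complement of
    [W], hence by properness at least [dm w * rho / (C * lambda)] from the complement of the image
    of [W]. Nearer points thus have preimages in [W], and [geo_lower] puts these in the ball of
    radius [rho] around [x], inside [U]. *)
Lemma inner_ball U W x lambda : open U -> open W -> U x -> W x ->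
  proper_factor W x lambda ->
  exists2 c, 0 < c & forall w z, w != [::] -> mdist (word_map w x) z < c * dm w ->
    (word_map w @` U) z.
Proof.
move=> oU oW Ux Wx [l1 Hl].
have : nbhs x (U `&` W) by apply: open_nbhs_nbhs; split; [exact: openI|].
move=> /nbhs_ballP[rho /= rho0 rhoUW].
have l0 : 0 < lambda by rewrite (lt_le_trans _ l1).
have Cl0 : 0 < C * lambda by rewrite mulr_gt0.
exists (rho / (C * lambda)); first by rewrite divr_gt0.
move=> w z w0 xz.
have [y Wy yz] : (word_map w @` W) z.
  apply: contrapT => nz.
  have h1 : ((dm w * rho / C)%:E <= edist_inf (word_map w @` (~` W)) (word_map w x))%E.
    apply: edist_inf_ge => _ [y nWy <-]; rewrite ler_pdivrMr// mulrC.
    rewrite [leRHS]mulrC (le_trans _ (geo_lower G w x y))// mulrC ler_pM2l//.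
    rewrite leNgt; apply/negP => xy; apply: nWy; apply: (rhoUW _ _).2.
    by rewrite ballEmdist.
  have h2 : (edist_inf (~` (word_map w @` W)) (word_map w x) <=
      (mdist (word_map w x) z)%:E)%E.
    exact: edist_inf_le.
  have := le_trans h1 (le_trans (Hl w w0) (lee_wpmul2l _ h2)).
  rewrite !lee_fin => /(_ (ltW l0)); apply/negP; rewrite -ltNge.
  rewrite -ltr_pdivlMl// (lt_le_trans xz)//.
  by rewrite le_eqVlt; apply/orP; left; apply/eqP; field; rewrite !lt0r_neq0.
exists y => //; apply: (rhoUW _ _).1; rewrite ballEmdist/=.
rewrite -(ltr_pM2l (dm_gt0 w)) (le_lt_trans (geo_lower G w x y))// yz.
rewrite -ltr_pdivlMl// (lt_le_trans xz)//.
rewrite (_ : C^-1 * _ = lambda * (rho / (C * lambda) * dm w)); last first.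
  by field; rewrite !lt0r_neq0.
by rewrite ler_peMl// mulr_ge0 ?divr_ge0// ltW.
Qed.

Lemma osc_disjoint_balls U x c : osc_set phi U ->
  (forall w z, w != [::] -> mdist (word_map w x) z < c * dm w -> (word_map w @` U) z) ->
  forall v w (r : R), v != [::] -> w != [::] -> ~~ prefix v w -> ~~ prefix w v ->
  r <= c * dm v -> r <= c * dm w ->
  ball (word_map v x) r `&` ball (word_map w x) r = set0.
Proof.
move=> [_ _ disjU] Hc v w r v0 w0 nvw nwv rv rw.
apply/seteqP; split=> // z []; rewrite !ballEmdist/= => vz wz.
have : (word_map v @` U `&` word_map w @` U) z.
  by split; apply: Hc => //; apply: lt_le_trans; eassumption.
by rewrite disjU//; apply/incomparableP.
Qed.

Lemma antichain_nprefix Q v w : antichain Q -> v \in Q -> w \in Q -> v <> w ->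
  ~~ prefix v w.
Proof. by move=> [_ aQ] vQ wQ vw; apply/negP => /(aQ _ _ vQ wQ). Qed.

(** Density gives [x] in both [U] and [W]. After refinement the images of [x] lie within
    [(1 + C * L) * r] of the centre and carry disjoint balls of radius [c * eta * r], so packing
    applies. *)
Lemma osc_bounded_clusters W : doubling M -> dense W -> open W ->
  (forall x, W x -> exists lambda, proper_factor W x lambda) ->
  open_set_condition phi -> bounded_clusters.
Proof.
move=> dM dW oW HW [U HU]; have [U0 oU _] := HU.
have [x [Ux Wx]] := dW _ U0 oU; have [lambda Hl] := HW x Wx.
have [c c0 Hc] := inner_ball oU oW Ux Wx Hl.
have [[a Ea] _ _] := HE.
pose L := dm [::] + mdist a x.
have L0 : 0 < L by rewrite ltr_wpDr// mdist_ge0.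
have xL e : E e -> mdist e x <= L.
  move=> Ee; rewrite (le_trans (metric_triangle _ a _))// lerD2r.
  by rewrite (mdist_dm G)// piece_nil.
have ce0 : 0 < c * eta by rewrite mulr_gt0.
have [K HK] := packing dM ((1 + C * L) / (c * eta)).
exists 1 => //; exists K => Q y r cQ; have r0 : 0 < r by case: cQ.
have [Q' [<- aQ' nQ' HQ']] := cluster_refine HE G cQ.
have neq0 w : w \in Q' -> w != [::] by move=> wQ; apply: contraNneq nQ' => <-.
apply: (HK _ Q' (fun w => word_map w x) y (c * eta * r)) => //.
- by rewrite mulr_gt0.
- by case: aQ'.
- move=> w /HQ'[/andP[sw _] _ [_ [e Ee <-] ye]].
  rewrite mulrA divfK ?lt0r_neq0// (le_lt_trans (metric_triangle _ (word_map w e) _))//.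
  rewrite mul1r in ye; rewrite mulrDl mul1r ltr_leD// (le_trans (geo_upper G _ _ _))//.
  rewrite -!mulrA ler_pM2l// mulrC ler_pM ?mdist_ge0 ?(ltW (dm_gt0 _))//.
  exact: xL.
- move=> v w vQ wQ; apply: contraPP => vw /set0P.
  rewrite (osc_disjoint_balls HU Hc) ?eqxx ?neq0//.
  + exact: (antichain_nprefix aQ').
  + by apply: (antichain_nprefix aQ') => // /esym.
  + by rewrite -mulrA ler_pM2l// ltW// (stops_ge G)//; case: (HQ' v).
  + by rewrite -mulrA ler_pM2l// ltW// (stops_ge G)//; case: (HQ' w).
Qed.

Lemma sosc_ball_condition W : dense W -> open W ->
  (forall x, W x -> exists lambda, proper_factor W x lambda) ->
  strong_open_set_condition phi E -> ball_condition phi E.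
Proof.
move=> dW oW HW [U [HU [e [Ue Ee]]]]; have [_ oU _] := HU.
(* Within [C^-1] of [e], the image of [x] stays closer than [dm w <= r] to the image of [e], a point
   of the piece. *)
have [|x [[Ux ex] Wx]] := dW (U `&` ball e C^-1) _ (openI oU (mball_open _ _)).
  by exists e; split=> //; apply: ballxx; rewrite invr_gt0.
have [lambda Hl] := HW x Wx.
have [c c0 Hc] := inner_ball oU oW Ux Wx Hl.
pose delta := Num.min (c * eta) 2^-1.
exists delta; split.
  by rewrite /delta lt_min mulr_gt0//= invr_gt0// ltr0n/= gt_min invf_lt1 ?ltr1n ?orbT.
move=> y Ey; exists 1; split=> // r /andP[r0 _].
exists (fun w => word_map w x); split.
  move=> w /(local_wordsP G)[/andP[sw _] _ _].
  rewrite -/(piece w) (@le_lt_trans _ _ (mdist (word_map w x) (word_map w e))%:E)//.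
    by apply: edist_inf_le; exists e.
  rewrite lte_fin (le_lt_trans (geo_upper G _ _ _))//.
  rewrite metric_sym; move: ex; rewrite ballEmdist/= => ex.
  rewrite (@lt_le_trans _ _ (C * dm w * C^-1)) ?ltr_pM2l ?mulr_gt0//.
  by rewrite mulrAC divff ?mul1r// lt0r_neq0.
move=> v w /(local_wordsP G)[sv _ _] /(local_wordsP G)[sw _ _].
apply: contraPP => vw /set0P; rewrite (osc_disjoint_balls HU Hc) ?eqxx//.
- exact: stops_neq0 sv.
- exact: stops_neq0 sw.
- by apply/negP => /(stops_prefix_eq HE G sv sw).
- by apply/negP => /(stops_prefix_eq HE G sw sv)/esym.
- rewrite (@le_trans _ _ (c * eta * r))//.
    by rewrite ler_wpM2r ?(ltW r0)// ge_min lexx.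
  by rewrite -mulrA ler_pM2l// ltW// (stops_ge G).
- rewrite (@le_trans _ _ (c * eta * r))//.
    by rewrite ler_wpM2r ?(ltW r0)// ge_min lexx.
  by rewrite -mulrA ler_pM2l// ltW// (stops_ge G).
Qed.

End open_sets.

(** * Mass of pieces, Frostman bounds and Hausdorff measure *)

Section level_mass.
Context {R : realType} {M : completeMetricType R} {I : finType}.
Variables (phi : I -> M -> M) (E : set M) (C s eta t B : R).
Implicit Types (v w u p q : seq I) (Q : seq (seq I)).

Local Notation dm := (piece_diam phi E).
Local Notation piece := (piece phi E).
Local Notation word_map := (word_map phi).
Local Notation stops := (stops phi E).
Local Notation word_cluster := (word_cluster phi E).
Local Notation bounded_clusters := (bounded_clusters phi E).

Hypotheses (HE : invariant_set phi E) (G : ifs_geometry phi E C s eta).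
Hypotheses (t0 : 0 < t) (B1 : 1 <= B)
  (psumB : forall n, B^-1 <= psum dm t n <= B).

Let C1 := geo_C1 G.
Let C0 : 0 < C. Proof. exact: lt_le_trans C1. Qed.
Let dm_gt0 := geo_gt0 G.
Let eta0 : 0 < eta. Proof. by have /andP[] := geo_eta G. Qed.
Let B0 : 0 < B. Proof. exact: lt_le_trans B1. Qed.
Let Ct0 : 0 < C `^ t. Proof. by rewrite powR_gt0. Qed.

Local Notation g := (fun w => dm w `^ t).

Let g_gt0 w : 0 < g w. Proof. by rewrite powR_gt0. Qed.

Lemma powR_le (a b : R) : 0 <= a -> a <= b -> a `^ t <= b `^ t.
Proof. by move=> a0 ab; rewrite ge0_ler_powR ?nnegrE ?(ltW t0)// (le_trans a0). Qed.

Lemma weight_cat_le v w : g (v ++ w) <= C `^ t * g v * g w.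
Proof.
rewrite -!powRM ?mulr_ge0 ?(ltW C0) ?(ltW (dm_gt0 _))//.
by rewrite powR_le ?(geo_mul_le G)// ltW.
Qed.

Lemma weight_cat_ge v w : g v * g w <= C `^ t * g (v ++ w).
Proof.
rewrite -!powRM ?mulr_ge0 ?(ltW C0) ?(ltW (dm_gt0 _))//.
by rewrite powR_le ?(geo_mul_ge G)// mulr_ge0// ltW.
Qed.

(** A finite-level substitute for the measure of the cylinder of [v]: it is additive over
    descendants by [massD], and comparable to the weight of [v] uniformly in [n]. *)
Definition mass n v : R := wsum n (fun w => g (v ++ w)).

Lemma mass0 v : mass 0 v = g v.
Proof. by rewrite /mass wsum0 cats0. Qed.

Lemma massD l n v : mass (l + n) v = wsum l (fun w => mass n (v ++ w)).
Proof.
rewrite /mass wsumD; apply: eq_wsum => w _; apply: eq_wsum => u _.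
by rewrite catA.
Qed.

Let A := C `^ t * B.
Let A0 : 0 < A. Proof. exact: mulr_gt0. Qed.

Lemma mass_le n v : mass n v <= A * g v.
Proof.
rewrite (@le_trans _ _ (C `^ t * g v * psum dm t n))//.
  by rewrite /mass /psum -wsumMl; apply: ler_wsum => w _; exact: weight_cat_le.
rewrite /A mulrAC ler_wpM2r ?(ltW (g_gt0 _))// ler_pM2l//.
by have /andP[] := psumB n.
Qed.

Lemma mass_ge n v : g v <= A * mass n v.
Proof.
rewrite /A mulrAC -ler_pdivrMr// (@le_trans _ _ (g v * psum dm t n))//.
  by rewrite ler_pM2l//; have /andP[] := psumB n.
rewrite /mass /psum -!wsumMl; apply: ler_wsum => w _; exact: weight_cat_ge.
Qed.

Lemma dm_le w (b : R) : 0 <= b ->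
  (forall x y, piece w x -> piece w y -> mdist x y <= b) -> dm w <= b.
Proof. by move=> b0 H; rewrite -lee_fin -(geo_diam G) diam_le. Qed.

Definition ball_mass l x (r : R) : R :=
  wsum l (fun w => if `[< piece w `<=` ball x r >] then g w else 0).

Definition frostman (N : R) : Prop := forall l x (r : R), 0 < r ->
  ball_mass l x r <= N * r `^ t.

Lemma bounded_clusters_frostman : bounded_clusters -> exists2 N, 0 < N & frostman N.
Proof.
move=> [eps1 eps10 [K HK1]].
(* As [eps <= 2^-1], a piece inside the ball has diameter at most [2 * r <= rho], hence a stopping
   prefix unless [dm [::] <= rho]. *)
pose eps := Num.min eps1 2^-1.
have eps0 : 0 < eps by rewrite lt_min eps10 invr_gt0//= ltr0n.
have HK Q x r : word_cluster eps Q x r -> (size Q <= K)%N.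
  by move=> /(cluster_le _)/HK1; apply; rewrite ge_min lexx.
have ee0 : 0 < eps * eta by rewrite mulr_gt0.
pose N1 := B / (dm [::] * (eps * eta)) `^ t.
pose N2 := K%:R * (A / (eps * eta) `^ t).
have N10 : 0 < N1 by rewrite divr_gt0// powR_gt0// mulr_gt0.
have N20 : 0 <= N2 by rewrite mulr_ge0// divr_ge0 ?powR_ge0// ltW.
exists (N1 + N2); first by rewrite ltr_pwDl.
move=> l x r r0; pose rho := r / (eps * eta).
have rho0 : 0 < rho by rewrite divr_gt0.
have rt0 : 0 < r `^ t by rewrite powR_gt0.
have rhot : rho `^ t = r `^ t / (eps * eta) `^ t.
  have eet0 : 0 < (eps * eta) `^ t by rewrite powR_gt0.
  apply: (mulIf (lt0r_neq0 eet0)); rewrite divfK ?lt0r_neq0// -powRM ?ltW//.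
  by rewrite /rho divfK// lt0r_neq0.
(* When [E] itself is too small to have stopping prefixes, the total mass is at most [B], and [N1]
   accounts for it. *)
rewrite mulrDl; have [big|small] := leP (dm [::]) rho.
  apply: ler_wpDr; first exact: mulr_ge0 N20 (ltW rt0).
  rewrite (@le_trans _ _ (psum dm t l))//.
    by apply: ler_wsum => w _; case: ifP => // _; rewrite ltW.
  have /andP[_ /le_trans] := psumB l; apply.
  rewrite /N1 mulrAC ler_pdivlMr ?powR_gt0 ?mulr_gt0// ler_pM2l//.
  by rewrite powR_le ?mulr_ge0 ?(ltW (dm_gt0 _)) ?(ltW eps0) ?(ltW eta0)// -ler_pdivlMr.
apply: ler_wpDl; first exact: mulr_ge0 (ltW N10) (ltW rt0).
have /choice[f Hf] : forall w, exists u, piece w `<=` ball x r ->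
    [/\ prefix u w, u != [::] & stops rho u].
  move=> w; have [wx|nwx] := pselect (piece w `<=` ball x r); last by exists [::].
  have [|u [_ h1 h2 h3]] := stopping_prefix small (prefix0s w) _.
    rewrite (@le_trans _ _ (r + r))//.
      apply: dm_le => [|y z /wx + /wx]; first exact: addr_ge0 (ltW r0) (ltW r0).
      rewrite !ballEmdist/= => xy xz; rewrite (le_trans (metric_triangle _ x _))//.
      by rewrite lerD ?(ltW xz)// metric_sym ltW.
    rewrite ler_pdivlMr// -mulr2n -mulr_natl -mulrA mulrCA ler_piMr ?(ltW r0)//.
    have /andP[_ eta1] := geo_eta G.
    have e2 : eps <= 2^-1 by rewrite ge_min lexx orbT.
    by move: e2 eps0 eta0; nra.
  by exists u => _; split=> //; rewrite eq_sym.
pose Q := undup [seq f (tval w) |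
  w : l.-tuple I <- enum {: l.-tuple I} & `[< piece (tval w) `<=` ball x r >]].
have QP u : u \in Q -> exists w, [/\ size w = l, piece w `<=` ball x r & u = f w].
  rewrite mem_undup => /mapP[w]; rewrite mem_filter => /andP[/asboolP wx _ ->].
  by exists (tval w); rewrite size_tuple.
have clQ : word_cluster eps Q x (eta * rho).
  split.
  - by rewrite mulr_gt0.
  - split; first exact: undup_uniq.
    move=> u v /QP[w [_ /Hf[_ _ su] ->]] /QP[w' [_ /Hf[_ _ sv] ->]].
    exact: (stops_prefix_eq HE G su sv).
  - by apply/negP => /QP[w [_ /Hf[_ + _]]] => /[swap] <-; rewrite eqxx.
  - move=> u /QP[w [_ wx ->]]; have [h1 h2 h3] := Hf _ wx.
    split; first exact: (stops_ge G).
    have [e we] := piece_neq0 HE w; exists e; first exact: (piece_sub_prefix HE h1).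
    move: (wx _ we); rewrite ballEmdist/= => xe.
    by rewrite mulrA [ltRHS]mulrC divfK// lt0r_neq0.
have -> : N2 * r `^ t = K%:R * (A * rho `^ t).
  by rewrite rhot /N2; ring.
apply: (@le_trans _ _ ((size Q)%:R * (A * rho `^ t))); last first.
  by rewrite ler_wpM2r ?ler_nat ?(HK _ _ _ clQ)// mulr_ge0 ?powR_ge0// ltW.
apply: (@le_trans _ _ (\sum_(u <- Q) wsum l (fun w => if prefix u w then g w else 0))).
  rewrite /wsum exchange_big/=; apply: ler_sum => w _.
  have ge0 u : 0 <= if prefix u w then g w else 0 by case: ifP => // _; rewrite ltW.
  case: ifPn => [/asboolP wx|_]; last by apply: sumr_ge0 => u _; exact: ge0.
  have [h1 _ _] := Hf _ wx.
  have fQ : f w \in Q.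
    rewrite mem_undup; apply/mapP; exists w => //.
    by rewrite mem_filter mem_enum andbT; apply/asboolP.
  rewrite (bigD1_seq (f w))//= ?undup_uniq// h1 ler_wpDr//.
  by apply: sumr_ge0 => u _; exact: ge0.
have -> : (size Q)%:R * (A * rho `^ t) = \sum_(u <- Q) (A * rho `^ t).
  by rewrite big_const_seq count_predT iter_addr_0 mulr_natl.
rewrite big_seq [leRHS]big_seq; apply: ler_sum => u /QP[w [wl wx ->]].
have [h1 _ /andP[h3 _]] := Hf _ wx.
rewrite wsum_prefix; last by rewrite -wl; exact: size_prefix.
rewrite (le_trans (mass_le _ _))// ler_pM2l// powR_le//; exact: ltW.
Qed.

Lemma frostman_bounded_clusters N : frostman N -> bounded_clusters.
Proof.
move=> HN; exists 1 => //.
pose k := N * (2 / eta) `^ t * A.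
exists (Num.truncn k).+1 => Q x r cQ; have r0 : 0 < r by case: cQ.
have [Q' [<- [uQ' aQ'] _ HQ']] := cluster_refine HE G cQ.
pose l := \max_(w <- Q') size w.
have lQ w : w \in Q' -> (size w <= l)%N.
  by move=> wQ; rewrite /l (big_rem w)//= leq_maxl.
have wx w : w \in Q' -> piece w `<=` ball x (2 * r).
  move=> /HQ'[/andP[sw _] _ [e we xe]] y wy; rewrite ballEmdist/=.
  rewrite (le_lt_trans (metric_triangle _ e _))// mulr_natl mulr2n ltr_leD//.
    by rewrite -[ltRHS]mul1r.
  by rewrite (le_trans (mdist_dm G we wy)).
have r20 : 0 < 2 * r by rewrite mulr_gt0.
have up := HN l x _ r20.
have low : (size Q')%:R * ((eta * r) `^ t / A) <= ball_mass l x (2 * r).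
  apply: (@le_trans _ _ (\sum_(w <- Q') wsum l (fun u => if prefix w u then g u else 0))).
    have -> : (size Q')%:R * ((eta * r) `^ t / A) = \sum_(u <- Q') ((eta * r) `^ t / A).
      by rewrite big_const_seq count_predT iter_addr_0 mulr_natl.
    rewrite big_seq [leRHS]big_seq; apply: ler_sum => w wQ.
    rewrite wsum_prefix ?lQ// ler_pdivrMr// [leRHS]mulrC (le_trans _ (mass_ge _ _))//.
    rewrite powR_le ?mulr_ge0 ?(ltW eta0) ?(ltW r0)// ltW// (stops_ge G)//.
    by case: (HQ' w wQ).
  rewrite /wsum exchange_big/=; apply: ler_sum => u _.
  have [/hasP[w wQ wu]|/hasPn nQ] := boolP (has (fun w => prefix w u) Q').
    rewrite (bigD1_seq w)//= wu [X in _ + X]big1_seq ?addr0.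
      case: ifPn => // /asboolP; case; apply: subset_trans (wx _ wQ).
      exact: (piece_sub_prefix HE wu).
    move=> v /andP[vw vQ]; case: ifPn => // vu.
    by case/orP: (prefix_total vu wu) vw =>
      [/(aQ' _ _ vQ wQ)|/(aQ' _ _ wQ vQ)] ->; rewrite eqxx.
  rewrite big1_seq; first by case: ifP => // _; rewrite ltW.
  by move=> w /andP[_ /nQ/negbTE ->].
have er0 : 0 < (eta * r) `^ t by rewrite powR_gt0// mulr_gt0.
have : (size Q')%:R <= k.
  have := le_trans low up; rewrite mulrA ler_pdivrMr// -ler_pdivlMr//.
  move=> /le_trans; apply; rewrite le_eqVlt; apply/orP; left; apply/eqP.
  rewrite /k (_ : 2 * r = 2 / eta * (eta * r)); last by field; exact: lt0r_neq0.
  have e2 : 0 <= 2 / eta by rewrite ltW// divr_gt0.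
  have e3 : 0 <= eta * r by rewrite ltW// mulr_gt0.
  by rewrite (powRM _ e2 e3); field; exact: lt0r_neq0.
move=> /le_lt_trans/(_ (truncnS_gt k)); rewrite ltr_nat.
exact: ltnW.
Qed.


(** Mass distribution at a finite level: by compactness a cover of [E], slightly enlarged, has a
    finite subcover, and balls three times as large contain every piece of some deep level, of total
    mass at least [B^-1]. *)
Lemma frostman_hausdorff_gt0 N : 0 < N -> frostman N ->
  (0 < hausdorff_measure t E)%E.
Proof.
move=> N0 HN; have Bi0 : 0 < B^-1 by rewrite invr_gt0.
have N3 : 0 < N * 3 `^ t by rewrite mulr_gt0// powR_gt0.
pose c := B^-1 / (N * 3 `^ t * 4).
have c0 : 0 < c by rewrite divr_gt0// mulr_gt0.
apply: (@lt_le_trans _ _ (hausdorff_premeasure t 1 E)); last first.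
  by apply: ereal_sup_ubound; exists 1 => //=; exact: ltr01.
apply: (@lt_le_trans _ _ c%:E); first by rewrite lte_fin.
apply: le_ereal_inf_tmp => _ [U [EU dU] <-]; rewrite leNgt; apply/negP => Uc.
have gauge_ge0 k : (0 <= hausdorff_gauge t (U k))%E.
  by rewrite /hausdorff_gauge; case: ifP => // _; exact: poweR_ge0.
have Ufin k : diam (U k) \is a fin_num.
  by rewrite ge0_fin_numE ?diam_ge0// (le_lt_trans (dU k))// ltry.
pose d k := fine (diam (U k)).
have dE k : diam (U k) = (d k)%:E by rewrite fineK.
have d0 k : 0 <= d k by rewrite fine_ge0// diam_ge0.
have gaugeE k : hausdorff_gauge t (U k) = (d k `^ t)%:E.
  rewrite /hausdorff_gauge; case: ifPn => [/eqP Uk|_]; last by rewrite dE poweR_EFin.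
  by rewrite /d Uk diam_set0 /= powR0 ?lt0r_neq0.
pose e k : R := c / 2 ^+ k.+1.
have e0 k : 0 < e k by rewrite divr_gt0// exprn_gt0.
pose r k := (d k `^ t + e k) `^ t^-1.
have rt k : r k `^ t = d k `^ t + e k.
  by rewrite /r -powRrM mulVf ?lt0r_neq0// powRr1// addr_ge0 ?powR_ge0// ltW.
have r0 k : 0 < r k by rewrite powR_gt0// ltr_wpDl// powR_ge0.
have dr k : d k < r k.
  rewrite ltNge; apply/negP => rd; have := powR_le (ltW (r0 k)) rd.
  by rewrite rt leNgt ltrDl e0.
have esum m : \sum_(k < m) e k <= c.
  suff -> : \sum_(k < m) e k = c - c / 2 ^+ m.
    by rewrite gerBl divr_ge0 ?exprn_ge0 ?(ltW c0).
  elim: m => [|m IH]; first by rewrite big_ord0 expr0 divr1 subrr.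
  rewrite big_ord_recr/= IH /e exprS; field.
  by rewrite lt0r_neq0// exprn_gt0.
have /choice[y Hy] : forall k, exists y, U k !=set0 -> U k y.
  move=> k; have [[y Uy]|nU] := pselect (U k !=set0); first by exists y.
  by exists point.
pose V k := \bigcup_(z in U k) ball z (r k).
have Vball k : V k `<=` ball (y k) (2 * r k).
  move=> x [z Uz]; rewrite !ballEmdist/= => zx.
  rewrite (le_lt_trans (metric_triangle _ z _))// mulr_natl mulr2n ler_ltD//.
  rewrite (le_trans _ (ltW (dr k)))// -lee_fin -dE mdist_le_diam//.
  by apply: Hy; exists z.
have [_ + _] := HE; rewrite compact_cover => /(_ nat setT V) [||D _ ED].
- by move=> k _; apply: bigcup_open => z _; exact: mball_open.
- move=> x /EU[k _ Ukx]; exists k => //; exists x => //; exact: ballxx.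
pose m := (\max_(k <- D) k).+1.
have Dm k : k \in D -> (k < m)%N.
  by move=> kD; rewrite ltnS (big_rem k)//= leq_maxl.
(* A piece of diameter below [rho] that meets some [V k] of the subcover stays in the ball of radius
   [3 * r k]. *)
have [rho rho0 Hrho] : exists2 rho : R, 0 < rho & forall k, (k < m)%N -> rho <= r k.
  elim: (m) => [|j [rho rho0 Hrho]]; first by exists 1.
  exists (Num.min rho (r j)); first by rewrite lt_min rho0 r0.
  move=> k; rewrite ltnS leq_eqVlt => /predU1P[->|kj].
    by rewrite ge_min lexx orbT.
  by rewrite ge_min Hrho.
have [n Hn] := dm_small G rho0.
have {}Hn w : size w = n -> exists2 k, (k < m)%N & piece w `<=` ball (y k) (3 * r k).
  move=> wn; have [x wx] := piece_neq0 HE w.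
  have [k /Dm km /Vball] := ED _ (piece_sub HE wx).
  rewrite ballEmdist/= => yx; exists k => // z wz; rewrite ballEmdist/=.
  rewrite (le_lt_trans (metric_triangle _ x _))//.
  rewrite (_ : 3 * r k = 2 * r k + r k); last by ring.
  rewrite ltr_leD// (le_trans (mdist_dm G wx wz))// (le_trans _ (Hrho k km))// ltW//.
  by rewrite Hn// wn.
have le1 : psum dm t n <= \sum_(k < m) ball_mass n (y k) (3 * r k).
  rewrite /ball_mass /wsum exchange_big/=; apply: ler_sum => w _.
  have [k km wk] := Hn w (size_tuple w).
  rewrite (bigD1 (Ordinal km))//=; case: ifPn => [_|/asboolP//].
  by rewrite ler_wpDr//; apply: sumr_ge0 => j _; case: ifP => // _; rewrite ltW.
have le2 : psum dm t n <= N * 3 `^ t * (c + c).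
  rewrite (le_trans le1)//.
  rewrite (@le_trans _ _ (\sum_(k < m) N * 3 `^ t * (d k `^ t + e k)))//.
    apply: ler_sum => k _; have r30 : 0 < 3 * r k by rewrite mulr_gt0.
    by rewrite (le_trans (HN _ _ _ r30))// powRM ?(ltW (r0 _))// rt mulrA.
  rewrite -mulr_sumr ler_pM2l// big_split/= lerD ?esum// -lee_fin.
  rewrite -sumEFin (le_trans _ (ltW Uc))//.
  under eq_bigr do rewrite -gaugeE.
  rewrite -(big_mkord xpredT (fun k => hausdorff_gauge t (U k))).
  exact: nneseries_lim_ge.
have /andP[le3 _] := psumB n.
have := le_trans le3 le2; apply/negP; rewrite -ltNge.
have -> : N * 3 `^ t * (c + c) = B^-1 / 2.
  by rewrite /c; field; rewrite !lt0r_neq0// powR_gt0.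
by rewrite ltr_pdivrMr// ltr_pMr// ltr1n.
Qed.


(** * Finite covers and upper bounds for the premeasure *)

Definition covers (delta : R) (S : set M) (b : R) : Prop := exists Us : seq (set M),
  [/\ S `<=` \big[setU/set0]_(U <- Us) U,
      List.Forall (fun U => (diam U <= delta%:E)%E) Us &
      (\sum_(U <- Us) hausdorff_gauge t U <= b%:E)%E].

Lemma covers_sub delta S S' b b' : S' `<=` S -> b <= b' -> covers delta S b ->
  covers delta S' b'.
Proof.
move=> SS bb [Us [h1 h2 h3]]; exists Us; split=> //; first exact: subset_trans h1.
by rewrite (le_trans h3)// lee_fin.
Qed.

Lemma covers0 delta : covers delta set0 0.
Proof. by exists [::]; split=> //; rewrite big_nil. Qed.

Lemma coversU delta S S' b b' : covers delta S b -> covers delta S' b' ->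
  covers delta (S `|` S') (b + b').
Proof.
move=> [Us [h1 h2 h3]] [Us' [h1' h2' h3']]; exists (Us ++ Us'); split.
- by rewrite big_cat; exact: setUSS.
- exact/List.Forall_app.
- by rewrite big_cat/= EFinD leeD.
Qed.

Lemma covers_wsum delta l (F : seq I -> set M) (b : seq I -> R) :
  (forall w, size w = l -> covers delta (F w) (b w)) ->
  covers delta (\bigcup_(w in [set w | size w = l]) F w) (wsum l b).
Proof.
move=> H.
apply: (@covers_sub _ (\big[setU/set0]_(w : l.-tuple I) F w) _ _ _ _ (lexx _)).
  move=> x [w wl Fx]; have lw : size w == l by rewrite wl.
  by rewrite (bigD1 (Tuple lw))//=; left.
rewrite /wsum; elim/big_ind2: _ => [|S b1 S' b2|w _]; first exact: covers0.
  exact: coversU.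
by apply: H; rewrite size_tuple.
Qed.

Lemma gauge_le (U : set M) (b : R) : 0 <= b -> (diam U <= b%:E)%E ->
  (hausdorff_gauge t U <= (b `^ t)%:E)%E.
Proof.
move=> b0 Ub; rewrite /hausdorff_gauge; case: ifP => _.
  by rewrite lee_fin powR_ge0.
have Ufin : diam U \is a fin_num.
  by rewrite ge0_fin_numE ?diam_ge0// (le_lt_trans Ub)// ltry.
move: Ub; rewrite -(fineK Ufin) poweR_EFin !lee_fin => Ub.
by rewrite powR_le// fine_ge0// diam_ge0.
Qed.

Lemma covers1 delta (U : set M) (b : R) : 0 <= b -> b <= delta -> (diam U <= b%:E)%E ->
  covers delta U (b `^ t).
Proof.
move=> b0 bd Ub; exists [:: U]; split.
- by rewrite big_seq1.
- by constructor => //; rewrite (le_trans Ub)// lee_fin.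
- by rewrite big_seq1 gauge_le.
Qed.

(** The list is padded to a sequence by empty sets, of gauge 0. *)
Lemma hausdorff_premeasure_covers delta S b : covers delta S b -> 0 <= delta ->
  (hausdorff_premeasure t delta S <= b%:E)%E.
Proof.
move=> [Us [h1 h2 h3]] d0.
have gauge0 : hausdorff_gauge t (set0 : set M) = 0%E by rewrite /hausdorff_gauge eqxx.
apply: le_trans h3; rewrite (big_nth set0) big_mkord.
apply: ereal_inf_lbound; exists (nth set0 Us) => /=.
  split=> [x /h1|k].
    rewrite (big_nth set0) big_mkord -bigcup_mkord => -[k _ xk].
    by exists k.
  have [kU|kU] := ltnP k (size Us).
    by elim: (Us) k h2 kU => [//|V Vs IH] [|k] /List.Forall_cons_iff[? ?]//= /IH; apply.
  by rewrite nth_default// diam_set0 lee_fin.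
rewrite (nneseries_split 0 (size Us)) => [|k _]; last first.
  by rewrite /hausdorff_gauge; case: ifP => // _; exact: poweR_ge0.
rewrite add0n big_mkord eseries0 ?adde0// => k kU _.
by rewrite nth_default.
Qed.


(* If the pieces of level [l] inside one ball carry more mass than [N r^t], then
   replacing them by a single set, and repeating this inside the image of every
   other piece, covers everything at a cost of order [1 / N], up to a fraction of
   the mass which tends to [0] geometrically. *)
Lemma covers_piece N l x (r delta : R) : 0 < N -> 0 < r -> 0 < delta ->
  N * r `^ t < ball_mass l x r ->
  exists theta delta', [/\ 0 <= theta < 1, 0 < delta' &
    forall k v, dm v <= delta' -> covers delta (piece v)
      (((2 * C) `^ t * C `^ t * A / N + theta ^+ k) * mass (k * l) v)].
Proof.
move=> N0 r0 delta0; set Gam := ball_mass l x r => NG.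
pose inside w := `[< piece w `<=` ball x r >].
have rt0 : 0 < r `^ t by rewrite powR_gt0.
have G0 : 0 < Gam by rewrite (le_lt_trans _ NG)// mulr_ge0 ?powR_ge0// ltW.
have mass_gt0 n v : 0 < mass n v.
  by rewrite -(pmulr_rgt0 _ A0) (lt_le_trans (g_gt0 v))// mass_ge.
(* The mass below [v] is split into the part [mc] passing through inside words and the rest [mn]. *)
pose mc k v := wsum l (fun w => if inside w then mass (k * l) (v ++ w) else 0).
pose mn k v := wsum l (fun w => if inside w then 0 else mass (k * l) (v ++ w)).
have mass_split k v : mass (k.+1 * l) v = mc k v + mn k v.
  rewrite mulSn massD /mc /mn /wsum -big_split; apply: eq_bigr => w _ /=.
  by case: ifP; rewrite ?addr0 ?add0r.
have mn_ge0 k v : 0 <= mn k v.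
  by apply: wsum_ge0 => w _; case: ifP => // _; rewrite ltW.
have mc_ge k v : g v * Gam <= C `^ t * A * mc k v.
  rewrite /Gam /ball_mass -!wsumMl; apply: ler_wsum => w _.
  rewrite -/(inside w); case: ifP => _; last by rewrite !mulr0.
  rewrite (le_trans (weight_cat_ge v w))// -mulrA ler_pM2l//; exact: mass_ge.
have CA0 : 0 < C `^ t * A by rewrite mulr_gt0.
(* By quasi-multiplicativity the inside words carry at least this fraction of the mass below any
   [v]. *)
pose kap := Gam / (C `^ t * A * A).
have kap0 : 0 < kap by rewrite divr_gt0// mulr_gt0.
have mc_kap k v : kap * mass (k.+1 * l) v <= mc k v.
  rewrite /kap mulrAC ler_pdivrMr ?mulr_gt0//.
  rewrite (@le_trans _ _ (Gam * (A * g v)))//; first by rewrite ler_pM2l// mass_le.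
  rewrite (_ : Gam * _ = A * (g v * Gam)); last by ring.
  rewrite (_ : mc k v * _ = A * (C `^ t * A * mc k v)); last by ring.
  by rewrite ler_pM2l.
pose theta := 1 - kap.
have mn_theta k v : mn k v <= theta * mass (k.+1 * l) v.
  have := mc_kap k v; rewrite /theta mass_split; move: (mc k v) (mn k v) => b b'.
  by lra.
have theta0 : 0 <= theta.
  by rewrite -(pmulr_lge0 _ (mass_gt0 (1 * l)%N [::])) (le_trans (mn_ge0 0%N [::])).
(* The second bound keeps the image of the ball under [v] at diameter at most [delta]. *)
pose delta' := Num.min delta (delta / (2 * C * r)).
have Cr0 : 0 < 2 * C * r by rewrite !mulr_gt0.
exists theta, delta'; split.
- by rewrite theta0 /theta gtrBl.
- by rewrite /delta' lt_min delta0 divr_gt0.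
move=> k; elim: k => [|k IH] v.
  rewrite le_min => /andP[vd _]; rewrite mul0n mass0 expr0.
  apply: (@covers_sub _ (piece v) _ (g v)) => //.
    rewrite ler_peMl ?(ltW (g_gt0 _))// lerDr divr_ge0 ?(ltW N0)//.
    rewrite !mulr_ge0 ?powR_ge0//.
    exact: ltW.
  by apply: covers1; rewrite ?(geo_diam G)// ltW.
move=> vd; have vd2 : 2 * C * r * dm v <= delta.
  by rewrite mulrC -ler_pdivlMr// (le_trans vd)// ge_min lexx orbT.
pose S := word_map v @` (E `&` ball x r).
have S_diam : (diam S <= (2 * C * r * dm v)%:E)%E.
  apply: diam_le => [|_ _ [y [_ +] <-] [z [_ +] <-]]; first by rewrite mulr_ge0// ltW.
  rewrite !ballEmdist/= => xy xz; rewrite (le_trans (geo_upper G _ _ _))//.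
  rewrite (_ : 2 * C * r * dm v = C * dm v * (r + r)); last by ring.
  rewrite ler_pM2l ?mulr_gt0// (le_trans (metric_triangle _ x _))//.
  by rewrite lerD ?(ltW xz)// metric_sym ltW.
have cS : covers delta S ((2 * C * r * dm v) `^ t).
  by apply: covers1 => //; rewrite mulr_ge0// ltW.
set a := (2 * C) `^ t * C `^ t * A / N in IH *.
have a0 : 0 <= a.
  by rewrite /a divr_ge0 ?(ltW N0)// mulr_ge0 ?(ltW A0)// mulr_ge0 ?powR_ge0.
have cw w : size w = l -> covers delta (if inside w then set0 else piece (v ++ w))
    ((a + theta ^+ k) * if inside w then 0 else mass (k * l) (v ++ w)).
  move=> _; case: ifP => _; first by rewrite mulr0; exact: covers0.
  apply: IH; rewrite (le_trans _ vd)//; exact: (dm_prefix HE G (prefix_prefix v w)).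
apply: (covers_sub _ _ (coversU cS (covers_wsum cw))).
  move=> y vy; have [u ul uy] := piece_extend HE l vy.
  have [iu|niu] := boolP (inside u).
    left; move: uy; rewrite piece_cat => -[z uz <-]; exists z => //; split.
      exact: (piece_sub HE uz).
    by move: iu => /asboolP; apply.
  by right; exists u => //; rewrite (negbTE niu).
rewrite wsumMl -/(mn k v).
have S_cost : (2 * C * r * dm v) `^ t <= a * mc k v.
  have C20 : 0 <= 2 * C by rewrite mulr_ge0// ltW.
  rewrite -mulrA (powRM _ C20) ?mulr_ge0 ?(ltW r0) ?(ltW (dm_gt0 _))//.
  rewrite (powRM _ (ltW r0) (ltW (dm_gt0 v))).
  rewrite (_ : a * _ = (2 * C) `^ t * (N^-1 * (C `^ t * A * mc k v))); last first.
    by rewrite /a; ring.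
  rewrite ler_pM2l ?powR_gt0 ?mulr_gt0// ler_pdivlMl//.
  rewrite (le_trans _ (mc_ge k v))// mulrA [leRHS]mulrC ler_pM2r//.
  exact: ltW.
rewrite (@le_trans _ _ (a * mc k v + a * mn k v + theta ^+ k * mn k v))//.
  by rewrite [(a + _) * _]mulrDl addrA lerD2r lerD2r.
rewrite -mulrDr -mass_split [leRHS]mulrDl lerD2l exprSr -mulrA.
by rewrite ler_wpM2l ?exprn_ge0.
Qed.

Lemma hausdorff_gt0_frostman : (0 < hausdorff_measure t E)%E ->
  exists2 N, 0 < N & frostman N.
Proof.
move=> H0; apply: contrapT => nF; move: H0; apply/negP; rewrite -leNgt.
apply: ge_ereal_sup => _ [delta /= delta0 <-].
apply/lee_addgt0Pr => eps eps0; rewrite add0e.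
pose a := (2 * C) `^ t * C `^ t * A.
have a0 : 0 < a by rewrite /a !mulr_gt0 ?powR_gt0 ?mulr_gt0.
(* The two parts of the cost, [a / N] and [theta ^+ k], each times a total mass of at most [B], then
   contribute at most [eps / 2]. *)
pose N := 2 * a * B / eps.
have N0 : 0 < N by apply: divr_gt0 => //; apply: mulr_gt0 => //; exact: mulr_gt0.
have [l [x [r [r0 Nr]]]] : exists l x r, 0 < r /\ N * r `^ t < ball_mass l x r.
  apply: contrapT => nN; apply: nF; exists N => // l x r r0.
  by rewrite leNgt; apply/negP => h; apply: nN; exists l, x, r.
have [theta [delta' [theta01 delta'0]]] := covers_piece N0 r0 delta0 Nr.
rewrite -/a => Hc.
have [k Hk] : exists k, theta ^+ k < eps / (2 * B).
  have /andP[th0 th1] := theta01.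
  have eB0 : 0 < eps / (2 * B) by rewrite divr_gt0 ?mulr_gt0.
  have /cvgrPdist_lt/(_ _ eB0) : theta ^+ n @[n --> \oo] --> (0 : R).
    by apply: cvg_expr; rewrite ger0_norm.
  move=> [n _ /(_ n (leqnn n))]; rewrite /= sub0r normrN ger0_norm ?exprn_ge0// => h.
  by exists n.
have [n Hn] := dm_small G delta'0.
have cE : covers delta E ((a / N + theta ^+ k) * psum dm t (n + k * l)).
  have -> : psum dm t (n + k * l) = wsum n (mass (k * l)).
    by rewrite -[LHS]/(mass (n + k * l) [::]) massD.
  rewrite -wsumMl; apply: (covers_sub _ (lexx _) (covers_wsum (F := piece) _)).
    move=> y Ey; have [|u un uy] := @piece_extend _ _ _ _ _ HE [::] y n.
      by rewrite piece_nil.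
    by exists u.
  by move=> w wn; apply: Hc; rewrite ltW// Hn// wn.
rewrite (le_trans (hausdorff_premeasure_covers cE (ltW delta0)))// lee_fin.
have /andP[_ pB] := psumB (n + k * l).
rewrite (@le_trans _ _ ((a / N + theta ^+ k) * B))//.
  apply: ler_wpM2l => //; apply: addr_ge0; first exact: divr_ge0 (ltW a0) (ltW N0).
  by rewrite exprn_ge0//; case/andP: theta01.
rewrite -ler_pdivlMr// (_ : eps / B = a / N + eps / (2 * B)).
  by rewrite lerD2l ltW.
by rewrite /N; field; rewrite !lt0r_neq0.
Qed.

End level_mass.

(** * The equivalence *)

Theorem theorem4p9 (R : realType) (M : completeMetricType R) (I : finType)
    (phi : I -> M -> M) (E : set M) :
  doubling M -> (2 <= #|I|)%N -> is_ifs phi -> invariant_set phi E ->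
  properly_semiconformal phi E ->
  [<-> ball_condition phi E;
       exists t : R, pressure_zero phi E t /\ (0 < hausdorff_measure t E)%E;
       open_set_condition phi;
       strong_open_set_condition phi E].
Proof.
move=> dM cardI _ HE [semi [W [dW oW _ _ HW]]].
have [C [s [eta G]]] := semiconformal_geometry HE semi.
have I0 : #|I| != 0%N by rewrite -lt0n (leq_trans _ cardI).
have /andP[eta0 _] := geo_eta G.
have C1 := geo_C1 G; have dm0 := geo_gt0 G.
have mul_le := geo_mul_le G; have mul_ge := geo_mul_ge G.
have [t [t0 pt t_uniq]] := press_zero cardI C1 (geo_s G) eta0 dm0 mul_le mul_ge
  (geo_decay G) (dm_ge_expr G).
have [B B1 psumB] := psum_bounds cardI C1 dm0 mul_le mul_ge (ltW t0) pt.
have frostman_iff : bounded_clusters phi E <-> (0 < hausdorff_measure t E)%E.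
  split=> [/(bounded_clusters_frostman HE G t0 B1 psumB)[N N0 NF]|].
    exact: (frostman_hausdorff_gt0 HE G t0 B1 psumB N0 NF).
  move=> /(hausdorff_gt0_frostman HE G t0 B1 psumB)[N _].
  exact: (frostman_bounded_clusters HE G t0 B1 psumB).
have osc_bounded := osc_bounded_clusters HE G I0 dM dW oW HW.
have bounded_sosc := bounded_clusters_sosc HE G I0.
(* The first three implications of the cycle pass through bounded clusters; the last uses [W]
   directly. *)
tfae.
- move=> /(ball_condition_bounded_clusters HE G dM)/frostman_iff Ht.
  exists t; split=> //; split; first by split=> //; exact: ltW.
  by move=> u [u0 pu]; rewrite (t_uniq u).
(* Any zero of the pressure is the [t] constructed above, for which the mass bounds hold. *)
- move=> [u [[[u0 pu] _]]]; rewrite (t_uniq u u0 pu) => /frostman_iff/bounded_sosc.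
  by move=> [U [HU _]]; exists U.
- by move=> /osc_bounded/bounded_sosc.
- exact: (sosc_ball_condition HE G I0 dW oW HW).
Qed.
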